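(* Let $G$ be a finite solvable group which is not a cyclic $p$-group for any prime $p$, and let $G'$ denote its derived subgroup. If $G/G'$ is not a $p$-group for any prime $p$, then $\sigma_0(G)=2$. Otherwise, $\sigma_0(G)=\sigma(G)$.
   Context: For a finite group $G$, a covering of $G$ is a family of proper subgroups of $G$ whose union equals $G$; the covering number $\sigma(G)$ is the smallest size of a covering of $G$, with $\sigma(G)=\infty$ if $G$ is cyclic. A primary element of $G$ is an element whose order is a prime power (the identity is included), and $G_0$ denotes the set of primary elements. A primary covering of $G$ is a family of proper subgroups of $G$ whose union contains $G_0$; the primary covering number $\sigma_0(G)$ is the smallest size of a primary covering of $G$, with $\sigma_0(G)=\infty$ if $G$ is a cyclic $p$-group for some prime $p$ (exactly the case in which no primary covering exists). The trivial group is regarded as a (cyclic) $p$-group. *)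

(* Defs.v *)
From mathcomp Require Import all_boot all_fingroup all_solvable.

Set Implicit Arguments.
Unset Strict Implicit.
Unset Printing Implicit Defensive.

Local Open Scope group_scope.

Section CoveringNumbers.

Variable gT : finGroupType.
Implicit Types (G H : {group gT}) (F : {set {group gT}}) (x : gT).

(* [p_group A] says that #|A| is a power of some prime, 1 included;          *)
(* since #|<[x]>| = #[x], this is the set of elements of prime power order,  *)
(* see primaryP below.                                                       *)
Definition primary (A : {set gT}) : {set gT} := [set x in A | p_group <[x]>].

Definition is_covering G F :=
  [forall H in F, H \proper G] && (\bigcup_(H in F) H == G :> {set gT}).

Definition is_primary_covering G F :=
  [forall H in F, H \proper G] && (primary G \subset \bigcup_(H in F) H).

(* The smallest size of a family satisfying P, where None stands for         *)
(* infinity and is the value when there is no such family.                   *)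
Definition min_size (P : pred {set {group gT}}) : option nat :=
  if [pick F | P F] is Some F0
  then Some #|[arg min_(F < F0 | P F) #|F| ]| else None.

Definition sigma G := min_size (is_covering G).
Definition sigma0 G := min_size (is_primary_covering G).

Lemma primaryP (A : {set gT}) x :
  reflect (x \in A /\ exists p k, prime p /\ #[x] = (p ^ k)%N)
          (x \in primary A).
Proof.
rewrite inE; apply: (iffP andP) => [] [xA].
  case/p_groupP=> p p_pr /p_natP[k xk]; split=> //.
  by exists p, k.
case=> p [k [p_pr xk]]; split=> //.
apply: (@pgroup_p _ p); rewrite /pgroup -orderE xk.
by rewrite pnatX pnat_id.
Qed.

Lemma min_sizeP (P : pred {set {group gT}}) n :
  min_size P = Some n <->
  (exists2 F, P F & #|F| = n) /\ (forall F, P F -> n <= #|F|).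
Proof.
rewrite /min_size; case: pickP => [F0 PF0 | P0]; last first.
  by split=> // [[[F PF _] _]]; rewrite P0 in PF.
case: arg_minnP => // F PF minF; split=> [[<-] | [[F1 PF1 <-] minF1]].
  by split=> //; exists F.
by congr Some; apply/eqP; rewrite eqn_leq minF ?minF1.
Qed.

Lemma min_sizeN (P : pred {set {group gT}}) :
  min_size P = None <-> (forall F, ~~ P F).
Proof.
rewrite /min_size; case: pickP => [F0 PF0 | P0].
  by split=> // /(_ F0); rewrite PF0.
by split=> // _ F; rewrite P0.
Qed.

Lemma sigma_infty G : sigma G = None <-> cyclic G.
Proof.
split=> [/min_sizeN noF | /cyclicP[x defG]]; last apply/min_sizeN=> F.
  apply: contraT => ncycG; have /negP[] := noF [set H : {group gT} | H \proper G].
  apply/andP; split; first by apply/forall_inP=> H; rewrite inE.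
  rewrite eqEsubset; apply/andP; split.
    by apply/bigcupsP=> H; rewrite inE => /proper_sub.
  apply/subsetP=> x Gx; apply/bigcupP; exists <[x]>%G; last exact: cycle_id.
  rewrite inE properEneq cycle_subG Gx andbT.
  by apply: contraNneq ncycG => <-; apply: cycle_cyclic.
apply/negP=> /andP[/forall_inP prF /eqP covF].
have: x \in (G : {set gT}) by rewrite defG cycle_id.
rewrite -covF => /bigcupP[H /prF/proper_subn/negP nGH Hx].
by apply: nGH; rewrite defG cycle_subG.
Qed.

Lemma sigma0_infty G : sigma0 G = None <-> cyclic G && p_group G.
Proof.
split=> [/min_sizeN noF | /andP[/cyclicP[x defG] pG]]; last apply/min_sizeN=> F.
  apply: contraT => ncycG; have /negP[] := noF [set H : {group gT} | H \proper G].
  apply/andP; split; first by apply/forall_inP=> H; rewrite inE.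
  apply/subsetP=> x; rewrite inE => /andP[Gx px].
  apply/bigcupP; exists <[x]>%G; last exact: cycle_id.
  rewrite inE properEneq cycle_subG Gx andbT.
  by apply: contraNneq ncycG => <-; rewrite cycle_cyclic.
apply/negP=> /andP[/forall_inP prF /subsetP covF].
have: x \in primary G by rewrite inE -defG pG defG cycle_id.
case/covF/bigcupP=> H /prF/proper_subn/negP nGH Hx.
by apply: nGH; rewrite defG cycle_subG.
Qed.

End CoveringNumbers.

(* Main.v *)
Require Import Defs.
From mathcomp Require Import all_boot all_fingroup all_solvable.
From mathcomp Require Import zmodp mxrepresentation mxabelem.

(**
The inequality [sigma0 G <= sigma G] is clear, and when G / G' is not a p-group
the preimages of 'O_p(G / G') and 'O_p^'(G / G') contain all primary elements.
Let G / G' be a p-group and let F be a primary covering of G; by induction on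
#|G| we find a covering with at most #|F| members.  Let N be a minimal normal
subgroup.  If H N < G for all H in F, pass to G / N.  Otherwise N has a
complement, and a complement T outside F is primarily covered by the T :&: H,
so that a covering of T lifts to G.  If all complements of N belong to F, then
#|F| > #|N|, because the elements of N^# need one more subgroup, and one has to
cover G by #|N| + 1 subgroups.  If N is central, G has an elementary abelian
quotient of order #|N| ^ 2.  If G / C_G(N) is abelian and nontrivial, C_G(N) and
the conjugates of a complement do this, since elements outside C_G(N) act on N
without fixed points.  Otherwise the faithful irreducible group M = G / C_G(N)
has such a covering: if M / M' is not cyclic, p + 1 <= #|N| + 1 subgroups
suffice; if it is cyclic, let M' / L be a chief factor; then #|M' / L| + 1
subgroups cover M / L, and everything rests on #|M' / L| <= #|N|.

For that bound M' / L is replaced by R / Phi(R), where R is an r-group normal in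
some B <= M and R / Phi(R) is a chief factor of B.  When r does not divide #|N|,
decompose N with respect to B-invariant abelian subgroups D of R: the
components are the C_N(H), for H <= D maximal with C_N(H) != 1.  If
subgroups T(H) of R are attached to the H in a B-equivariant way, the
intersection of the T(H) Phi(R) is R or Phi(R); in the second case #|R : Phi(R)|
is bounded by the product of the indices #|R : T(H)|, one for each R-orbit.
Applied with T(H) = N_R(H) and then T(H) = C_R(D / H), this shows that we may
assume all such D central in R; then R has class at most 2, and a count of fixed
points on the Z(R)-components concludes.
*)

Set Implicit Arguments.
Unset Strict Implicit.
Unset Printing Implicit Defensive.

Local Open Scope group_scope.

(** * Groups of class two acting with a fixed-point-free center *)

(* Either some w != 1 in W has 'C_R[w] <= 'Z(R), and its orbit is long enough, *)
(* or a noncentral x fixes a point.  In that case the 'C_W[x ^ y], for y not   *)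
(* commuting with x, meets 'C_W[x] trivially, so #|'C_W[x]| ^ 2 <= #|W|, and   *)
(* induction applies to 'C_R[x] acting on 'C_W[x].                             *)
Lemma center_index_le (gT : finGroupType) (r : nat) (Z0 R W : {group gT}) :
    r.-group R -> R \subset 'N(W) -> Z0 \subset 'Z(R) -> R^`(1) \subset Z0 ->
    #|Z0| = r -> prime r -> {in Z0^#, forall z, 'C_W[z] = 1} -> W :!=: 1 ->
  #|R : 'Z(R)| <= #|W|.
Proof.
elim: {R}_.+1 {-2}R W (ltnSn #|R|) => // n IHn R W.
rewrite ltnS => leRn rR nWR sZ0Z sR'Z0 oZ0 r_pr regZ0 ntW.
have [v Wv ntv] := trivgPn _ ntW.
have sWR : v ^: R \subset W by rewrite class_sub_norm.
have [sCZ | /subsetPn[x /setIP[Rx cvx] nZx]] := boolP ('C_R[v] \subset 'Z(R)).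
  by apply: leq_trans (subset_leq_card sWR); rewrite -index_cent1 dvdn_leq ?indexgS.
pose W1 := 'C_W[x]; pose Q := 'C_R[x].
have sQR : Q \subset R by apply: subsetIl.
have rQ : r.-group Q by apply: pgroupS rR.
have W1v : v \in W1 by rewrite inE Wv cent1C.
have ntW1 : W1 != 1 by apply/trivgPn; exists v.
have nW1Q : Q \subset 'N(W1).
  by apply: normsI; [apply: subset_trans nWR | apply: subset_trans (subsetIr R _) (normG _)].
have sZQ : 'Z(R) \subset 'Z(Q).
  rewrite subsetI; apply/andP; split.
    rewrite subsetI subsetIl -cent_set1.
    by apply: subset_trans (subsetIr _ _) (centS _); rewrite sub1set.
  by apply: subset_trans (subsetIr _ _) (centS _).
have ltQR : Q \proper R.
  rewrite properE sQR; apply: contra nZx => sRQ; rewrite inE Rx /=.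
  apply/centP=> y /(subsetP sRQ)/setIP[_ /cent1P].
  by move/commute_sym.
have sW1 : W1 \subset W by apply: subsetIl.
have IH : #|Q : 'Z(Q)| <= #|W1|.
  apply: IHn => //.
  - exact: leq_trans (proper_card ltQR) leRn.
  - exact: subset_trans sZ0Z sZQ.
  - exact: subset_trans (dergS 1 sQR) sR'Z0.
  - move=> z /regZ0 /trivgP rz; apply/trivgP; apply: subset_trans rz.
    exact: setSI.
have [_ [y Ry nQy]] := properP ltQR.
have comZ0 (a b : gT) : a \in R -> b \in R -> [~ a, b] \in Z0.
  by move=> Ra Rb; apply: (subsetP sR'Z0); rewrite mem_commg.
(* A [w] fixed by [x] and by [x ^ y] is fixed by [[~ x, y]], a nontrivial element of [Z0]. *)
have TI : W1 :&: W1 :^ y = 1.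
  apply/trivgP/subsetP=> w /setIP[/setIP[Ww cxw]].
  rewrite mem_conjg => /setIP[_ cxw'].
  have nz : [~ x, y] \in Z0^#.
    rewrite !inE comZ0 // andbT; apply: contra nQy => /commgP cxy.
    by rewrite inE Ry; apply/cent1P.
  rewrite -(regZ0 _ nz) inE Ww /=; apply/cent1P.
  have cw1 : commute w x by apply/cent1P.
  have cw2 : commute w (x ^ y).
    have /cent1P cw' : w ^ y^-1 \in 'C[x] by [].
    rewrite -[w](conjgKV y) /commute -!conjMg.
    by congr (_ ^ y); apply: cw'.
  by rewrite commgEl; apply: commuteM => //; apply: commuteV.
have leW : #|W1| * #|W1| <= #|W|.
  rewrite -{2}(cardJg W1 y) -TI_cardMg //; apply: subset_leq_card.
  by rewrite mul_subG // -(normsP nWR y Ry) conjSg.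
have class_le (A : {group gT}) a : A \subset R -> a \in R -> #|A : 'C_A[a]| <= r.
  move=> sAR Ra; rewrite index_cent1 -oZ0 -(card_lcoset Z0 a).
  apply: subset_leq_card; apply/subsetP=> _ /imsetP[b Ab ->].
  by rewrite mem_lcoset -commgEl; apply: comZ0 Ra (subsetP sAR b Ab).
(* [Z0] acts semiregularly on the nontrivial points, and the [Z0]-orbit of [v] stays in [W1]. *)
have ler : r <= #|W1|.
  have oC : #|Z0 : 'C_Z0[v]| = r.
    rewrite (_ : 'C_Z0[v] = 1) ?indexg1 //.
    apply/trivgP/subsetP=> z /setIP[Z0z cvz]; rewrite inE.
    apply: contraR ntv => ntz; have: v \in 'C_W[z] by rewrite inE Wv cent1C.
    by rewrite regZ0 !inE // ntz.
  rewrite -oC index_cent1; apply: subset_leq_card.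
  rewrite class_sub_norm //; apply: subset_trans nW1Q.
  by apply: subset_trans sZ0Z (subset_trans sZQ _); apply: subsetIl.
have oRQ : #|R : Q| = r.
  have : r.-nat #|R : Q| by apply: pnat_dvd rR; apply: dvdn_indexg.
  case/p_natP=> k ok; have := class_le R x (subxx _) Rx; rewrite -/Q ok.
  have : 1 < #|R : Q| by rewrite indexg_gt1 (proper_subn ltQR).
  rewrite ok; case: k {ok} => [|[|k]] // _.
  by rewrite -{2}[r]expn1 leq_exp2l ?prime_gt1.
have maxQ : maximal Q R by rewrite p_index_maximal // oRQ.
have genR : <<y |: Q>> = R.
  have [_ maxQ'] := maxgroupP maxQ.
  apply/eqP; rewrite eqEproper gen_subG subUset sub1set Ry sQR /=.
  apply/negP=> ltgR; have := maxQ' [group of <<y |: Q>>] ltgR.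
  rewrite sub_gen ?subsetUr // => /(_ isT) eQ.
  case/negP: nQy; have gy: y \in <<y |: Q>> by apply: mem_gen; apply: setU11.
  by rewrite -[Q]eQ.
(* As [R] is generated by [y] and [Q], an element of ['Z(Q)] commuting with [y] is central in
   [R]. *)
have ZQ : #|'Z(Q) : 'Z(R)| <= r.
  apply: leq_trans (class_le 'Z(Q)%G y _ Ry); last first.
    by apply: subset_trans sQR; apply: subsetIl.
  rewrite dvdn_leq ?indexgS //; apply/subsetP=> z /setIP[/setIP[Qz cQz] cyz].
  rewrite inE (subsetP sQR) //= -sub_cent1 -genR gen_subG subUset sub1set.
  by rewrite cent1C cyz /= sub_cent1.
have -> : #|R : 'Z(R)| = (r * (#|Q : 'Z(Q)| * #|'Z(Q) : 'Z(R)|))%N.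
  rewrite -oRQ (Lagrange_index (center_sub _) sZQ) Lagrange_index //.
  by rewrite (subset_trans sZQ) ?subsetIl.
apply: leq_trans leW.
have [abQ | nabQ] := boolP (abelian Q).
  have -> : 'Z(Q) = Q by apply/center_idP.
  by rewrite indexgg mul1n leq_mul // (leq_trans _ ler) // -{1}(center_idP abQ).
(* With a = [#|Q : 'Z(Q)|], the index of ['Z(R)] is at most r a r, and r ^ 2 <= a because
   [Q / 'Z(Q)] is not cyclic. *)
suff leQ : r * r <= #|Q : 'Z(Q)|.
  apply: leq_trans (leq_mul IH IH); apply: leq_trans (leq_mul (leqnn _) leQ).
  by rewrite mulnC -mulnA leq_mul2l mulnC leq_mul2l ZQ !orbT.
have : r.-nat #|Q : 'Z(Q)| by apply: pnat_dvd rQ; apply: dvdn_indexg.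
case/p_natP=> [[|[|k]]] ok.
- case/negP: nabQ; apply/center_idP/eqP; rewrite eqEcard subsetIl.
  by rewrite -{1}(Lagrange (center_sub Q)) ok muln1 leqnn.
- case/negP: nabQ; apply: cyclic_center_factor_abelian.
  by rewrite prime_cyclic // card_quotient ?gFnorm // ok expn1.
by rewrite ok !expnS mulnA leq_pmulr // expn_gt0 prime_gt0.
Qed.

(** * Fixed-point components of a coprime abelian action *)

Section Components.
Variable gT : finGroupType.
Implicit Types A B D G H K N R T X Y : {group gT}.

Lemma index_setI_le R A B : #|R : A :&: B| <= #|R : A| * #|R : B|.
Proof.
rewrite -(indexgI R (A :&: B)) setIA -(Lagrange_index (subsetIl R A) (subsetIl _ B)).
rewrite !indexgI leq_mul2l; apply/orP; right; apply: subset_leq_card.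
by rewrite imsetS ?subsetIl.
Qed.

Lemma index_bigcap_le (I : finType) (P : {set I}) R (K : I -> {group gT}) :
  #|R : \bigcap_(i in P) K i| <= \prod_(i in P) #|R : K i|.
Proof.
elim: {P}#|P| {-2}P (leqnn #|P|) => [|n IHn] P.
  rewrite leqn0 cards_eq0 => /eqP->; rewrite big_set0 big_set0.
  by rewrite (_ : #|R : _| = 1%N) //; apply/eqP; rewrite indexg_eq1 subsetT.
have [-> _ | [i Pi]] := set_0Vmem P.
  by rewrite big_set0 big_set0 (eqP (_ : #|R : [set: gT]%G| == 1%N)) // indexg_eq1 subsetT.
rewrite (cardsD1 i) Pi ltnS => leP.
rewrite (big_setD1 i) // [X in _ <= X](big_setD1 i) //=.
apply: leq_trans (index_setI_le R (K i) [group of \bigcap_(j in P :\ i) K j]) _.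
by rewrite leq_mul2l IHn ?orbT.
Qed.

(** [A] centralizes [X / [~: X, A]], and coprime fixed points lift, so this quotient is trivial. *)
Lemma coprime_abelian_commg_eq X A :
    abelian X -> A \subset 'N(X) -> coprime #|X| #|A| -> 'C_X(A) = 1 ->
  [~: X, A] = X.
Proof.
move=> abX nXA coXA cXA1; apply/eqP; rewrite eqEsubset commg_subl nXA /=.
have nRX : X \subset 'N([~: X, A]) := commg_norml _ _.
rewrite -quotient_sub1 //.
have := coprime_quotient_cent (_ : [~: X, A] \subset X) (commg_normr _ _) coXA (abelian_sol abX).
rewrite commg_subl nXA => /(_ isT); rewrite cXA1 quotient1 => e.
by rewrite e subsetI subxx quotient_cents2r.
Qed.

(** These are the maximal stabilizers in [D] of nontrivial points of [N]; the component attached to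
    [H] is ['C_N(H)]. *)
Definition fixcomp D N : {set {group gT}} :=
  [set H : {group gT} | [max H | (H \subset D) && ('C_N(H) != 1)]].

Lemma fixcompP D N H :
  reflect [/\ H \subset D, 'C_N(H) != 1 &
              forall K, K \subset D -> 'C_N(K) != 1 -> H \subset K -> K :=: H]
          (H \in fixcomp D N).
Proof.
rewrite inE; apply: (iffP maxgroupP) => [[/andP[sHD ntC] maxH] | [sHD ntC maxH]].
  by split=> // K sKD ntK; apply: maxH; rewrite sKD.
by split=> [|K /andP[]]; [rewrite sHD | apply: maxH].
Qed.

Arguments fixcompP {D N H}.

Lemma fixcompJ D N H x :
  x \in 'N(D) -> x \in 'N(N) -> H \in fixcomp D N -> (H :^ x)%G \in fixcomp D N.
Proof.
move=> nDx nNx /fixcompP[sHD ntC maxH]; apply/fixcompP.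
have eC K : 'C_N(K :^ x) = 'C_N(K) :^ x by rewrite conjIg (normP nNx) centJ.
split=> [||K sKD ntK sHK] /=.
- by rewrite -(normP nDx) conjSg.
- by rewrite eC -(conjs1g x) (inj_eq (@conjsg_inj _ x)).
have nx' : x^-1 \in 'N(D) by rewrite groupV.
have /= <- : (K :^ x^-1)%G :=: H; last by rewrite /= conjsgKV.
apply: maxH => /=; first by rewrite -(normP nx') conjSg.
  by rewrite -(inj_eq (@conjsg_inj _ x)) conjs1g -eC conjsgKV.
by rewrite -sub_conjg.
Qed.

Lemma fixcomp_exists D N : N :!=: 1 -> exists H, H \in fixcomp D N.
Proof.
move=> ntN; have [|H maxH _] := @maxgroup_exists _ (fun H => (H \subset D) && ('C_N(H) != 1)) 1%G.
  by rewrite sub1G cent1T setIT.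
by exists H; rewrite inE.
Qed.

Section Coprime.
Variables D N : {group gT}.
Hypotheses (abD : abelian D) (abN : abelian N) (nND : D \subset 'N(N)).
Hypothesis coND : coprime #|N| #|D|.

Lemma fixcomp_norm H : H \subset D -> D \subset 'N('C_N(H)).
Proof.
move=> sHD; apply: normsI => //; apply: norms_cent; apply: sub_abelian_norm => //.
Qed.

Lemma fixcomp_TI H K :
  H \in fixcomp D N -> K \in fixcomp D N -> H != K -> 'C_('C_N(H))(K) = 1.
Proof.
move=> /fixcompP[sHD _ maxH] /fixcompP[sKD _ maxK] neHK; apply/eqP.
apply: contraR neHK => ntC; apply/eqP/val_inj=> /=.
have ntJ : 'C_N(H <*> K) != 1 by rewrite centY setIA.
have sJD : H <*> K \subset D by rewrite join_subG sHD.
have eH := maxH (H <*> K)%G sJD ntJ (joing_subl _ _).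
by rewrite -eH -[RHS](maxK (H <*> K)%G sJD ntJ (joing_subr _ _)).
Qed.

(** The components are independent: [H] has no nontrivial fixed point on the group generated by the
    others. *)
Lemma fixcomp_prod_le : \prod_(H in fixcomp D N) #|'C_N(H)| <= #|N|.
Proof.
pose Y (P : {set {group gT}}) := <<\bigcup_(H in P) 'C_N(H)>>.
have sYN (P : {set {group gT}}) : Y P \subset N.
  by rewrite gen_subG; apply/bigcupsP=> H _; apply: subsetIl.
suff le (P : {set {group gT}}) : P \subset fixcomp D N -> \prod_(H in P) #|'C_N(H)| <= #|Y P|.
  by apply: leq_trans (le _ (subxx _)) _; apply: subset_leq_card.
elim: {P}#|P| {-2}P (leqnn #|P|) => [|n IHn] P.
  by rewrite leqn0 cards_eq0 => /eqP-> _; rewrite big_set0 cardG_gt0.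
have [-> _ _ | [H PH]] := set_0Vmem P; first by rewrite big_set0 cardG_gt0.
rewrite (cardsD1 H) PH ltnS => leP sP.
rewrite (big_setD1 H) //=; set Q := P :\ H.
have sQP : Q \subset P by apply: subD1set.
have FH := subsetP sP H PH; have [sHD _ _] := fixcompP FH.
have nYD : D \subset 'N(Y Q).
  apply: norms_gen; apply/subsetP=> x Dx; rewrite inE; apply/subsetP=> y.
  rewrite mem_conjg => /bigcupP[K QK yK]; apply/bigcupP; exists K => //.
  have [sKD _ _] := fixcompP (subsetP sP K (subsetP sQP K QK)).
  by move: yK; rewrite -mem_conjg (normsP (fixcomp_norm sKD)).
have abY : abelian (Y Q) := abelianS (sYN Q) abN.
have coYH : coprime #|Y Q| #|H|.
  by apply: coprimegS sHD (coprimeSg (sYN Q) coND).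
have nYH := subset_trans sHD nYD.
(* Each other component equals its commutator with [H], so it lies in [[~: Y Q, H]], which meets the
   fixed points of [H] trivially. *)
have cY1 : 'C_(Y Q)(H) = 1.
  rewrite -[RHS](coprime_abel_cent_TI nYH coYH abY); apply/eqP.
  rewrite eqEsubset [X in _ && X]setSI ?commg_subl // andbT setSI //.
  rewrite gen_subG; apply/bigcupsP=> K QK.
  have FK := subsetP sP K (subsetP sQP K QK); have [sKD _ _] := fixcompP FK.
  have neKH : K != H by case/setD1P: QK.
  rewrite -(@coprime_abelian_commg_eq ('C_N(K))%G H) //=.
  - by apply: commSg; apply: sub_gen; apply: bigcup_sup QK.
  - exact: abelianS (subsetIl _ _) abN.
  - exact: subset_trans sHD (fixcomp_norm sKD).
  - by apply: coprimegS sHD (coprimeSg (subsetIl _ _) coND).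
  exact: fixcomp_TI.
have TI : 'C_N(H) :&: Y Q = 1.
  by apply/trivgP; rewrite -cY1 subsetI subsetIr /= setIAC subsetIr.
apply: leq_trans (_ : #|'C_N(H) * Y Q| <= _).
  by rewrite TI_cardMg // leq_mul2l IHn ?orbT // (subset_trans sQP).
apply: subset_leq_card; rewrite mul_subG //.
  by apply: sub_gen; apply: bigcup_sup PH.
by apply: genS; apply/bigcupsP=> K QK; apply: bigcup_sup (subsetP sQP K QK).
Qed.

Lemma fixcomp_stab H w :
  H \in fixcomp D N -> w \in 'C_N(H) -> w != 1 -> 'C_D[w] = H.
Proof.
case/fixcompP=> sHD _ maxH /setIP[Nw cHw] ntw.
apply: (maxH 'C_D[w]%G) => /=; rewrite ?subsetIl //.
  by apply/trivgPn; exists w => //; rewrite inE Nw -sub_cent1 subsetIr.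
by rewrite subsetI sHD sub_cent1.
Qed.

(** A nontrivial point of the component has stabilizer exactly [H], and its [D]-orbit stays in the
    component. *)
Lemma fixcomp_index_le H : H \in fixcomp D N -> #|D : H| <= #|'C_N(H)|.
Proof.
move=> FH; have [sHD /trivgPn[w Cw ntw] _] := fixcompP FH.
rewrite -{1}(fixcomp_stab FH Cw ntw) index_cent1; apply: subset_leq_card.
by rewrite class_sub_norm // fixcomp_norm.
Qed.

(** [D] acts with kernel [H] on a minimal [D]-invariant subgroup of the component, and an abelian
    group with a faithful irreducible representation is cyclic. *)
Lemma fixcomp_cyclic H : H \in fixcomp D N -> cyclic (D / H).
Proof.
move=> FH; have [sHD ntC maxH] := fixcompP FH.
have [W minW sWC] := minnormal_exists ntC (fixcomp_norm sHD).
have [ntW nWD] := andP (mingroupp minW).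
have solW : solvable W.
  by apply: abelian_sol; apply: abelianS abN; apply: subset_trans sWC (subsetIl _ _).
have [_ _ /is_abelemP[p p_pr abelW]] := minnormal_solvable minW (subxx _) solW.
pose rD := abelem_repr abelW ntW nWD.
have irrD : mx_irreducible rD by apply/abelem_mx_irrP.
have kerD : rker rD = H.
  rewrite rker_abelem; apply/eqP; rewrite eqEsubset.
  have [w Ww ntw] := trivgPn _ ntW.
  rewrite -{1}(fixcomp_stab FH (subsetP sWC w Ww) ntw) setIS /=; last first.
    by rewrite -cent_set1 centS ?sub1set.
  by rewrite subsetI sHD centsC (subset_trans sWC) ?subsetIr.
rewrite -kerD; apply: mx_faithful_irr_abelian_cyclic (kquo_mx_faithful rD) _ _.
  by apply/quo_mx_irr.
exact: quotient_abelian.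
Qed.

End Coprime.
End Components.
Arguments fixcompP {gT D N H}.
Arguments fixcomp_exists {gT} D {N}.

(** Stated with subgroups of [R] to avoid the quotient [R / 'Phi(R)]; a trivial [R] is allowed. *)
Definition Phi_chief (gT : finGroupType) (R B : {group gT}) :=
  R <| B /\ forall X : {group gT}, 'Phi(R) \subset X -> X \subset R ->
    B \subset 'N(X) -> X :=: 'Phi(R) \/ X :=: R.

Lemma der1_Phi (gT : finGroupType) (r : nat) (R : {group gT}) :
  r.-group R -> R^`(1) \subset 'Phi(R).
Proof. by move=> rR; rewrite (Phi_joing rR) joing_subl. Qed.

(** * Equivariant families of subgroups attached to the components *)

Section Product.
Variables (gT : finGroupType) (r : nat) (R B N D : {group gT}).
Hypotheses (rR : r.-group R) (chR : Phi_chief R B).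
Hypotheses (abN : abelian N) (nNB : B \subset 'N(N)) (coNR : coprime #|N| #|R|).
Hypotheses (abD : abelian D) (sDR : D \subset R) (nDB : B \subset 'N(D)).

Lemma fixcomp_alternative (T : {group gT} -> {group gT}) :
    {in fixcomp D N, forall H, T H \subset R} ->
    {in fixcomp D N & B, forall H x, T (H :^ x)%G :=: T H :^ x} ->
    {in fixcomp D N, forall H,
       #|R : T H| <= \prod_(K in orbit 'JG R H) #|'C_N(K)|} ->
  #|R : 'Phi(R)| <= #|N| \/ {in fixcomp D N, forall H, T H :=: R}.
Proof.
move=> sTR TJ leT; set F := fixcomp D N.
have [[sRB nRB] chX] := (andP chR.1, chR.2).
have FJ H x : H \in F -> x \in B -> (H :^ x)%G \in F.
  by move=> FH Bx; apply: fixcompJ FH; [apply: (subsetP nDB) | apply: (subsetP nNB)].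
pose K H := (T H <*> 'Phi(R))%G.
have sKR H : H \in F -> K H \subset R by move=> FH; rewrite join_subG sTR ?Phi_sub.
have nKR H : H \in F -> R \subset 'N(K H).
  move=> FH; apply: normal_norm; apply: sub_der1_normal; last exact: sKR.
  exact: subset_trans (der1_Phi rR) (joing_subr _ _).
have nPB : B \subset 'N('Phi(R)) := gFnorm_trans _ nRB.
have KJ H x : H \in F -> x \in B -> K (H :^ x)%G :=: K H :^ x.
  by move=> FH Bx; rewrite /= TJ // conjYg (normsP nPB).
(* [K H] contains the derived subgroup of [R], so it is normal in [R] and depends only on the
   [R]-orbit of [H]. *)
have KJR H x : H \in F -> x \in R -> K (H :^ x)%G = K H.
  move=> FH Rx; apply: val_inj => /=.
  by rewrite [LHS](KJ _ _ FH (subsetP sRB x Rx)) (normsP (nKR H FH)).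
pose I := (R :&: \bigcap_(H in F) K H)%G.
have nIB : B \subset 'N(I).
  apply/subsetP=> x Bx; rewrite inE; apply/subsetP=> y; rewrite mem_conjg.
  case/setIP=> Ry /bigcapP yK; rewrite inE; apply/andP; split.
    by move: Ry; rewrite -mem_conjg (normsP nRB).
  apply/bigcapP=> H FH; have Bx' : x^-1 \in B by rewrite groupV.
  have := yK _ (FJ _ _ FH Bx'); rewrite (KJ _ _ FH Bx') => {}yK.
  by rewrite -[y](conjgKV x) in yK *; rewrite -(memJ_conjg _ x^-1).
have sPI : 'Phi(R) \subset I.
  by rewrite subsetI Phi_sub; apply/bigcapsP=> H _; apply: joing_subr.
have [eI | eI] := chX I sPI (subsetIl _ _) nIB; last first.
  right=> H FH; have eK : K H :=: R.
    apply/eqP; rewrite eqEsubset sKR //= -{1}eI subIset // orbC.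
    by rewrite (bigcap_inf H).
  have := @Phi_nongen _ R (T H); rewrite joingC => /(_ eK).
  by rewrite genGid.
left; pose O := orbit 'JG R @: F.
have actF : [acts R, on F | 'JG].
  apply/subsetP=> x Rx; rewrite !inE; apply/subsetP=> H FH.
  by rewrite inE; apply: FJ (subsetP sRB x Rx).
have partO : partition O F by apply: orbit_partition.
(* One representative per orbit; the default is never reached on members of [O], which are
   nonempty. *)
pose rep (S : {set {group gT}}) := odflt 1%G [pick H in S].
have repP S : S \in O -> exists2 H, H \in F & S = orbit 'JG R H /\ rep S = H.
  case/imsetP=> H FH eS; have SH : H \in S by rewrite eS orbit_refl.
  rewrite /rep; case: pickP => [L SL /= | /(_ H)]; last by rewrite SH.
  exists L; last by split=> //; rewrite eS; apply/esym/orbit_eqP; rewrite -eS.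
  by move: SL; rewrite eS; apply: subsetP; rewrite acts_sub_orbit.
have eIO : I :=: R :&: \bigcap_(S in O) K (rep S).
  congr (_ :&: _); apply/eqP; rewrite eqEsubset; apply/andP; split.
    apply/bigcapsP=> S /repP[H FH [_ ->]]; exact: bigcap_inf.
  apply/bigcapsP=> H FH; have OH : orbit 'JG R H \in O by apply: imset_f.
  have [L FL [eL eR]] := repP _ OH.
  apply: subset_trans (bigcap_inf _ OH) _; rewrite eR.
  have /orbitP[x Rx <-] : L \in orbit 'JG R H by rewrite eL orbit_refl.
  by rewrite KJR.
apply: leq_trans (fixcomp_prod_le abD abN _ _); first last.
- exact: coprimegS sDR coNR.
- exact: subset_trans sDR (subset_trans sRB nNB).
rewrite (set_partition_big _ partO) /= -eI eIO indexgI.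
apply: leq_trans (index_bigcap_le _ _ _) _; apply: leq_prod => S OS.
have [H FH [-> ->]] := repP S OS; apply: leq_trans (leT H FH).
by rewrite dvdn_leq ?indexgS ?joing_subl.
Qed.

End Product.

(** * Centralizers modulo a subgroup *)

Section CentralMod.
Variable gT : finGroupType.
Implicit Types (A D H R : {group gT}).

(* For H normalized by R and A this is the largest T <= R with [A, T] <= H. *)
Definition cent_mod R A H := (R :&: \bigcap_(d in A) 'N(H :* d))%G.

Lemma cent_modJ R A H x : x \in 'N(R) -> x \in 'N(A) ->
  cent_mod R A (H :^ x)%G :=: cent_mod R A H :^ x.
Proof.
move=> nRx nAx; rewrite /= conjIg (normP nRx); congr (_ :&: _).
apply/setP=> y; rewrite mem_conjg; apply/bigcapP/bigcapP=> h d Ad.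
  have := h (d ^ x); rewrite memJ_norm // => /(_ Ad).
  by rewrite -conjg_set1 -conjsMg normJ mem_conjg.
have := h (d ^ x^-1); rewrite memJ_norm ?groupV // => /(_ Ad).
rewrite -mem_conjg -normJ conjsMg conjg_set1 conjgKV //.
Qed.

Lemma cent_modP R A H x : R \subset 'N(H) -> A \subset 'N(H) ->
  reflect (x \in R /\ forall d, d \in A -> [~ d, x] \in H) (x \in cent_mod R A H).
Proof.
move=> nHR nHA.
suff eN d : x \in R -> d \in A -> (x \in 'N(H :* d)) = ([~ d, x] \in H).
  apply: (iffP setIP) => [[Rx /bigcapP h] | [Rx h]]; split=> //.
    by move=> d Ad; rewrite -eN // h.
  by apply/bigcapP=> d Ad; rewrite eN // h.
move=> Rx Ad; have nHx := subsetP nHR x Rx; have nHd := subsetP nHA d Ad.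
have -> : (x \in 'N(H :* d)) = (H :* d ^ x == H :* d).
  rewrite -conjg_set1 -{2}(normP nHx) -conjsMg.
  by apply/normP/eqP.
rewrite (sameP eqP rcoset_eqP) norm_rlcoset // mem_lcoset.
by rewrite commgEl.
Qed.

End CentralMod.

(** * Coprime irreducible action: invariant abelian subgroups *)

Section Irreducible.
Variables (gT : finGroupType) (r : nat) (R B N : {group gT}).
Hypotheses (r_pr : prime r) (rR : r.-group R) (chR : Phi_chief R B).
Hypotheses (abN : abelian N) (nNB : B \subset 'N(N)) (coNR : coprime #|N| #|R|).
Hypotheses (ntN : N :!=: 1) (ntR : R :!=: 1) (cNR : 'C_R(N) = 1).
Hypothesis irrN : forall Y : {group gT},
  Y \subset N -> B \subset 'N(Y) -> Y :!=: 1 -> Y :=: N.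

Let sRB : R \subset B := normal_sub chR.1.
Let nRB : B \subset 'N(R) := normal_norm chR.1.
Let nNR : R \subset 'N(N) := subset_trans sRB nNB.

(** The components generate a [B]-invariant subgroup, which is [N] by irreducibility, and [x]
    centralizes all of it. *)
Lemma fixcomp_core (D : {group gT}) x : B \subset 'N(D) -> x \in R ->
  (forall H, H \in fixcomp D N -> x \in H) -> x = 1.
Proof.
move=> nDB Rx xH; pose Y := <<\bigcup_(H in fixcomp D N) 'C_N(H)>>%G.
have sYN : Y \subset N by rewrite gen_subG; apply/bigcupsP=> H _; apply: subsetIl.
have eY : Y :=: N.
  apply: irrN => //=.
    apply: norms_gen; apply/subsetP=> b Bb; rewrite inE; apply/subsetP=> y.
    have FJ H : H \in fixcomp D N -> (H :^ b)%G \in fixcomp D N.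
      by apply: fixcompJ; [apply: (subsetP nDB) | apply: (subsetP nNB)].
    rewrite mem_conjg => /bigcupP[K FK yK]; apply/bigcupP.
    exists (K :^ b)%G; first exact: FJ.
    move: yK; rewrite -mem_conjg conjIg (normP (subsetP nNB b Bb)) /=.
    by rewrite centJ.
  have [H FH] := fixcomp_exists D ntN; have [_ ntC _] := fixcompP FH.
  apply: subG1_contra ntC; apply: sub_gen; exact: bigcup_sup FH.
have : x \in 'C_R(N).
  rewrite inE Rx -eY cent_gen; apply/centP=> y /bigcupP[H FH /setIP[_ cHy]].
  by apply: commute_sym; apply: (centP cHy); apply: xH.
by rewrite cNR => /set1P.
Qed.

Lemma cent_irr1 : 'C_N(R) = 1.
Proof.
apply/eqP; apply: contraR ntR => ntC.
have eC : 'C_N(R)%G :=: N.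
  by apply: irrN => //=; rewrite ?subsetIl // normsI // norms_cent.
apply/eqP; rewrite -cNR; apply/esym/setIidPl.
by rewrite centsC -eC subsetIr.
Qed.

Section Abelian.
Variable D : {group gT}.
Hypotheses (abD : abelian D) (sDR : D \subset R) (nDB : B \subset 'N(D)).

Let alt := fixcomp_alternative rR chR abN nNB coNR abD sDR nDB.
Let nND : D \subset 'N(N) := subset_trans sDR nNR.
Let coND : coprime #|N| #|D| := coprimegS sDR coNR.

Lemma leq_fixcomp_orbit (H : {group gT}) :
  #|'C_N(H)| <= \prod_(K in orbit 'JG R H) #|'C_N(K)|.
Proof.
by rewrite (big_setD1 H) ?orbit_refl //= leq_pmulr ?prodn_cond_gt0.
Qed.

(** With [T H] the normalizer of [H], the index is the orbit length n, and n <= 2 ^ n is at most the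
    product of n component orders, each at least 2. *)
Lemma fixcomp_norm_alternative :
  #|R : 'Phi(R)| <= #|N| \/ {in fixcomp D N, forall H : {group gT}, R \subset 'N(H)}.
Proof.
have [] // := alt (T := fun H => 'N_R(H)%G).
- by move=> H _; apply: subsetIl.
- by move=> H x FH Bx /=; rewrite conjIg normJ (normsP nRB).
- move=> H FH /=; have -> : #|R : 'N_R(H)| = #|orbit 'JG R H|.
    by rewrite card_orbit astab1JG.
  apply: leq_trans (_ : 2 ^ #|orbit 'JG R H| <= _).
    by apply: ltnW; apply: ltn_expl.
  rewrite -prod_nat_const; apply: leq_prod => _ /orbitP[x Rx <-].
  have Bx := subsetP sRB x Rx.
  have : (H :^ x)%G \in fixcomp D N.
    by apply: fixcompJ FH; [apply: (subsetP nDB) | apply: (subsetP nNB)].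
  by case/fixcompP=> _ ntC _; rewrite cardG_gt1.
by left.
by move=> h; right=> H /h /= <-; apply: subsetIr.
Qed.

(** If [cent_mod R D H] is always [R], then [[~: D, R]] lies in every [H] and is trivial by
    [fixcomp_core]. *)
Lemma fixcomp_central_alternative :
  #|R : 'Phi(R)| <= #|N| \/ D \subset 'Z(R).
Proof.
have [|nHR] := fixcomp_norm_alternative; first by left.
have [||| le | eT] := alt (T := fun H => cent_mod R D H).
- by move=> H _; apply: subsetIl.
- by move=> H x FH Bx /=; rewrite -cent_modJ ?(subsetP nRB) ?(subsetP nDB).
- move=> H FH; apply: leq_trans (leq_fixcomp_orbit H).
  apply: leq_trans (fixcomp_index_le abD nND FH).
  have /cyclicP[dH defD] := fixcomp_cyclic abD abN nND FH.
  have sHD : H \subset D by case/fixcompP: FH.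
  have nHR1 := nHR H FH; have nHD := subset_trans sDR nHR1.
  have /morphimP[d nHd Dd edH] : dH \in D / H by rewrite defD cycle_id.
  have Rd := subsetP sDR d Dd.
  (* As [d] generates [D] modulo [H], fixing the coset [H :* d] amounts to centralizing [D / H]; the
     conjugates of this coset are among the [#|D : H|] cosets of [H] in [D]. *)
  apply: leq_trans (_ : #|R : 'N_R(H :* d)| <= _); last first.
    rewrite -card_conjugates; apply: subset_leq_card.
    apply/subsetP=> _ /imsetP[x Rx ->].
    rewrite conjsMg conjg_set1 (normsP nHR1 x Rx) mem_rcosets.
    rewrite (subsetP (mulG_subr _ _)) // memJ_norm //.
    exact: (subsetP (subset_trans sRB nDB)).
  rewrite dvdn_leq ?indexgS //; apply/subsetP=> x /setIP[Rx nHdx].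
  have nHx := subsetP nHR1 x Rx.
  have ce : coset H (d ^ x) = coset H d.
    apply/esym/rcoset_kercosetP; rewrite ?groupJ //.
    rewrite -{1}(normP nHx) -conjg_set1 -conjsMg (normP nHdx) rcoset_refl //.
  apply/cent_modP=> //; split=> // e De.
  have nHe := subsetP nHD e De.
  apply: coset_idr; first by rewrite groupR.
  have : coset H e \in <[dH]> by rewrite -defD mem_quotient.
  have cdx : commute (coset H d) (coset H x).
    by apply/commgP; rewrite commgEl -morphJ //= ce mulVg.
  case/cycleP=> k ek; rewrite morphR //= ek edH.
  by apply/eqP/commgP/commute_sym/commuteX/commute_sym.
- by left.
right; rewrite subsetI sDR; apply/centsP=> d Dd x Rx; apply/commgP/eqP.
apply: (fixcomp_core nDB) => [|H FH]; first by rewrite groupR // (subsetP sDR).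
have nHR1 := nHR H FH; have := eT H FH => /(congr1 (fun A : {set gT} => x \in A)).
rewrite Rx => /idP/(cent_modP _ nHR1 (subset_trans sDR nHR1))[_]; exact.
Qed.

End Abelian.
End Irreducible.

(** * Coprime irreducible action: the bound *)

Section Irreducible.
Variables (gT : finGroupType) (r : nat) (R B N : {group gT}).
Hypotheses (r_pr : prime r) (rR : r.-group R) (chR : Phi_chief R B).
Hypotheses (abN : abelian N) (nNB : B \subset 'N(N)) (coNR : coprime #|N| #|R|).
Hypotheses (ntN : N :!=: 1) (ntR : R :!=: 1) (cNR : 'C_R(N) = 1).
Hypothesis irrN : forall Y : {group gT},
  Y \subset N -> B \subset 'N(Y) -> Y :!=: 1 -> Y :=: N.

Let sRB : R \subset B := normal_sub chR.1.
Let nRB : B \subset 'N(R) := normal_norm chR.1.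
Let nNR : R \subset 'N(N) := subset_trans sRB nNB.

(** For [D = R] and [T H = H], the second alternative would give [R] a nontrivial fixed point on
    [N]. *)
Lemma Phi_chief_abelian_le : abelian R -> #|R : 'Phi(R)| <= #|N|.
Proof.
move=> abR; have [] // := fixcomp_alternative rR chR abN nNB coNR abR (subxx R) nRB (T := id).
- by move=> H /fixcompP[].
- move=> H FH; apply: leq_trans (leq_fixcomp_orbit R N H).
  exact: fixcomp_index_le.
move=> eR; have [H FH] := fixcomp_exists R ntN.
have [_ /negP[]] := fixcompP FH; rewrite (eR H FH).
by rewrite (cent_irr1 chR nNB ntR cNR irrN).
Qed.

(** The center of a Thompson critical subgroup [K] is central in [R] by hypothesis; since
    ['C_R(K) = 'Z(K)], every element of [R] commuting with [K] is central. *)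
Lemma Phi_chief_class2 : ~~ abelian R ->
    (forall D : {group gT}, abelian D -> D \subset R -> B \subset 'N(D) -> D \subset 'Z(R)) ->
  [/\ 'Phi(R) = 'Z(R), R^`(1) \subset 'Z(R) & r.-abelem R^`(1)].
Proof.
move=> nabR central; have [K [chK sPK sRK cK]] := Thompson_critical rR.
have sKR := char_sub chK.
have sZKZ : 'Z(K) \subset 'Z(R).
  apply: central; first exact: center_abelian.
    exact: subset_trans (center_sub _) sKR.
  by apply: char_norm_trans nRB; apply: char_trans chK; apply: center_char.
have inCK x : x \in R -> (forall k, k \in K -> commute x k) -> x \in 'Z(R).
  move=> Rx cxK; apply: (subsetP sZKZ); rewrite -cK inE Rx.
  by apply/centP.
have cR x : x \in 'Z(R) -> forall y, y \in R -> commute x y.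
  by case/setIP=> _ /centP.
have RKZ : [~: R, K] \subset 'Z(R) := subset_trans sRK sZKZ.
have sR'Z : R^`(1) \subset 'Z(R).
  have RK1 : [~: R, K, R] = 1.
    by apply/commG1P; apply: subset_trans RKZ (subsetIr _ _).
  have KR1 : [~: K, R, R] = 1 by rewrite (commGC K).
  have /commG1P R'K := three_subgroup RK1 KR1.
  apply/subsetP=> x R'x; apply: inCK; first exact: (subsetP (der_sub 1 R)).
  by move=> k Kk; apply: (centsP R'K).
have sRrZ x : x \in R -> x ^+ r \in 'Z(R).
  move=> Rx; apply: inCK; first exact: groupX.
  move=> k Kk; have cxk : [~ x, k] \in 'Z(R) by apply: (subsetP RKZ); apply: mem_commg.
  have Rk := subsetP sKR k Kk.
  (* Here [[~ x ^+ r, k] = [~ x, k] ^+ r = [~ x, k ^+ r]], and [k ^+ r] lies in ['Phi(K)], hence in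
     ['Z(R)]. *)
  apply/commgP; rewrite commXg; last exact/commute_sym/(cR _ cxk).
  rewrite -commgX; last exact/commute_sym/(cR _ cxk).
  apply/commgP/commute_sym/cR => //; apply: (subsetP sZKZ); apply: (subsetP sPK).
  rewrite (Phi_joing (pgroupS sKR rR)) mem_gen // inE orbC -[r in _ ^+ r]expn1.
  by rewrite Mho_p_elt // (mem_p_elt rR).
have sPZ : 'Phi(R) \subset 'Z(R).
  rewrite (Phi_joing rR) join_subG sR'Z (MhoE _ rR) gen_subG expn1.
  by apply/subsetP=> _ /imsetP[x Rx ->]; apply: sRrZ.
split=> //.
  have nZB : B \subset 'N('Z(R)) by apply: char_norm_trans nRB; apply: center_char.
  have [-> // | eZ] := chR.2 'Z(R)%G sPZ (center_sub R) nZB.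
  by case/negP: nabR; apply/center_idP.
apply: abelemS (Ohm1_abelem (pgroupS (center_sub R) rR) (center_abelian R)).
rewrite gen_subG; apply/subsetP=> _ /imset2P[x y Rx Ry ->].
have rZ := pgroupS (center_sub R) rR.
have Zxy : [~ x, y] \in 'Z(R) by apply: (subsetP sR'Z); apply: mem_commg.
suff: [~ x, y] \in 'Ldiv_(r ^ 1)('Z(R)).
  by rewrite -(OhmEabelian rZ) // (abelianS (Ohm_sub 1 _) (center_abelian R)).
apply/LdivP; split=> //.
rewrite expn1 -commXg; last exact/commute_sym/(cR _ Zxy).
by apply/eqP/commgP/(cR _ (sRrZ x Rx)).
Qed.

(** Unless [H] contains the derived subgroup, the image of the latter in [R / H] has order r and
    acts without fixed points on the component, so [center_index_le] applies. *)
Lemma fixcomp_center_index_le (H : {group gT}) :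
    R^`(1) \subset 'Z(R) -> r.-abelem R^`(1) -> H \in fixcomp 'Z(R)%G N ->
  #|R : cent_mod R R H| <= #|'C_N(H)|.
Proof.
move=> sR'Z abR' FH; have [sHZ ntC _] := fixcompP FH.
have sZR : 'Z(R) \subset R := center_sub R.
have sHR := subset_trans sHZ sZR.
have nHR : R \subset 'N(H).
  by apply: cents_norm; rewrite centsC (subset_trans sHZ) ?subsetIr.
have nZN : 'Z(R) \subset 'N(N) := subset_trans sZR nNR.
have inT x : x \in R -> (forall d, d \in R -> [~ d, x] \in H) -> x \in cent_mod R R H.
  by move=> Rx h; apply/cent_modP.
have [sR'H | nsR'H] := boolP (R^`(1) \subset H).
  suff -> : cent_mod R R H :=: R by rewrite indexgg cardG_gt0.
  apply/eqP; rewrite eqEsubset subsetIl; apply/subsetP=> x Rx; apply: inT => // d Rd.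
  by apply: (subsetP sR'H); apply: mem_commg.
have nHW : 'C_N(H) \subset 'N(H) by apply: cents_norm; apply: subsetIr.
have TINR : N :&: R = 1 := coprime_TIg coNR.
have TIW : H :&: 'C_N(H) = 1.
  by apply/trivgP; rewrite /= setIC -TINR setISS // subsetIl.
have oW : #|'C_N(H) / H| = #|'C_N(H)|.
  by rewrite -(card_isog (quotient_isog nHW TIW)).
have nHR' : R^`(1) \subset 'N(H) := subset_trans (der_sub 1 R) nHR.
(* It is nontrivial, elementary abelian, and cyclic as a subgroup of ['Z(R) / H]. *)
have oZ0 : #|R^`(1) / H| = r.
  have abq : r.-abelem (R^`(1) / H) by apply: quotient_abelem.
  have cyc : cyclic (R^`(1) / H).
    apply: cyclicS (quotientS H sR'Z) _.
    by apply: fixcomp_cyclic FH => //; apply: center_abelian.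
  have rq := abelem_pgroup abq; rewrite (card_pgroup rq).
  rewrite (abelem_cyclic abq) in cyc.
  have : 0 < logn r #|R^`(1) / H|.
    rewrite lt0n; apply: contraNneq nsR'H => e0.
    by rewrite -quotient_sub1 // subG1 trivg_card1 (card_pgroup rq) e0.
  by case: (logn _ _) cyc => [|[|k]].
have le : #|R / H : 'Z(R / H)| <= #|'C_N(H) / H|.
  apply: (@center_index_le _ r (R^`(1) / H)%G) => //.
  - exact: quotient_pgroup.
  - apply: quotient_norms; apply: normsI => //.
    exact: norms_cent.
  - apply: subset_trans (quotientS H sR'Z) _; rewrite subsetI quotientS //=.
    by rewrite quotient_cents // subsetIr.
  - by rewrite /= -quotient_der.
  - move=> zb /setD1P[ntz /morphimP[z nHz R'z ezb]].
    apply/trivgP/subsetP=> wb /setIP[/morphimP[w nHw Ww ewb] czw].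
    have wz : [~ w, z] \in H.
      apply: coset_idr; rewrite ?groupR // morphR //= -ewb -ezb.
      by apply/eqP/commgP; apply: commute_sym; apply/cent1P; rewrite cent1C.
    have Nw : w \in N by case/setIP: Ww.
    have Rz := subsetP (der_sub 1 R) z R'z.
    have wz1 : [~ w, z] = 1.
      apply/set1P; rewrite -[[set 1]]TINR inE (subsetP sHR _ wz) andbT.
      by rewrite commgEl groupM ?groupV // memJ_norm // (subsetP nNR).
    have [w1 | ntw] := eqVneq w 1; first by rewrite ewb w1 morph1 inE.
    have Hz : z \in H.
      rewrite -(fixcomp_stab FH Ww ntw) inE (subsetP sR'Z) //=.
      by apply/cent1P/commute_sym/commgP/eqP.
    by case/eqP: ntz; rewrite ezb; apply: coset_id.
  by rewrite trivg_card1 oW -trivg_card1.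
rewrite -oW; apply: leq_trans le.
pose K := (R :&: coset H @*^-1 'Z(R / H))%G.
have sHK : H \subset K by rewrite subsetI sHR sub_cosetpre.
have eK : K / H = 'Z(R / H).
  by rewrite quotientGI ?sub_cosetpre // cosetpreK (setIidPr (center_sub _)).
rewrite -eK index_quotient_eq ?subsetIl //; last by rewrite (setIidPr sHR).
rewrite dvdn_leq ?indexgS //; apply/subsetP=> x /setIP[Rx].
case/morphpreP=> nHx /setIP[_ cx].
apply: inT => // d Rd; have nHd := subsetP nHR d Rd.
apply: coset_idr; first by rewrite groupR.
rewrite morphR //=; apply/eqP/commgP/commute_sym; apply: (centP cx).
exact: mem_quotient.
Qed.

(** If the bound failed, all [B]-invariant abelian subgroups of [R] would be central; the
    alternative for [D = 'Z(R)] would then put the derived subgroup in every [H], making [R]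
    abelian. *)
Lemma Phi_chief_irr_index_le : #|R : 'Phi(R)| <= #|N|.
Proof.
have [abR | nabR] := boolP (abelian R); first exact: Phi_chief_abelian_le.
rewrite leqNgt; apply/negP=> ltN; have nle : ~ (#|R : 'Phi(R)| <= #|N|) by rewrite leqNgt ltN.
have [||ePZ sR'Z abR'] := Phi_chief_class2 => //.
  move=> D abD sDR nDB.
  by case: (fixcomp_central_alternative rR chR abN nNB coNR ntN cNR irrN abD sDR nDB).
have nZB : B \subset 'N('Z(R)) by apply: char_norm_trans nRB; apply: center_char.
have [] // := fixcomp_alternative rR chR abN nNB coNR (center_abelian R) (center_sub R) nZB
  (T := fun H => cent_mod R R H).
- by move=> H _; apply: subsetIl.
- by move=> H x FH Bx /=; rewrite -cent_modJ ?(subsetP nRB).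
- move=> H FH; apply: leq_trans (leq_fixcomp_orbit R N H).
  exact: fixcomp_center_index_le.
move=> eT; case/negP: nabR; apply/commG1P/trivgP; rewrite gen_subG.
apply/subsetP=> _ /imset2P[x y Rx Ry ->]; apply/set1P.
apply: (fixcomp_core nNB ntN cNR irrN nZB) => [|H FH]; first exact: groupR.
have [sHZ _ _] := fixcompP FH.
have nHR : R \subset 'N(H).
  by apply: cents_norm; rewrite centsC (subset_trans sHZ) ?subsetIr.
have := eT H FH => /(congr1 (fun A : {set gT} => y \in A)).
by rewrite Ry => /idP/(cent_modP _ nHR nHR)[_]; apply.
Qed.

End Irreducible.

(** * Quotients by the kernel of the action *)

Section QuoPre.
Variable gT : finGroupType.
Implicit Types (B K G N R : {group gT}).

Lemma quo_preI K G (X : {group coset_of K}) :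
  X \subset G / K -> (G :&: coset K @*^-1 X) / K = X.
Proof.
by move=> sXG; rewrite quotientIG ?sub_cosetpre // cosetpreK (setIidPr sXG).
Qed.

Lemma norm_cosetpre K B (X : {group coset_of K}) :
  B \subset 'N(K) -> B / K \subset 'N(X) -> B \subset 'N(coset K @*^-1 X).
Proof.
move=> nKB nXB; apply: subset_trans (morphpre_norm _ _).
by rewrite -sub_quotient_pre.
Qed.

Lemma Phi_chief_quotient (r : nat) R B K :
    r.-group R -> Phi_chief R B -> B \subset 'N(K) -> R :&: K \subset 'Phi(R) ->
  Phi_chief (R / K)%G (B / K)%G /\ #|R / K : 'Phi(R / K)| = #|R : 'Phi(R)|.
Proof.
move=> rR [nsRB chX] nKB sRK; have [sRB nRB] := andP nsRB.
have nKR := subset_trans sRB nKB.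
rewrite -(quotient_Phi rR nKR) index_quotient_eq ?Phi_sub //.
split=> //; split; first exact: quotient_normal.
move=> X /=; rewrite -(quotient_Phi rR nKR) => sPX sXR nXB.
have eX := quo_preI sXR.
have nYB : B \subset 'N(R :&: coset K @*^-1 X) by rewrite normsI ?norm_cosetpre.
have sPY : 'Phi(R) \subset R :&: coset K @*^-1 X.
  by rewrite subsetI Phi_sub -sub_quotient_pre // (subset_trans (Phi_sub R)).
rewrite -eX; have [/= -> | /= ->] := chX [group of R :&: coset K @*^-1 X] sPY (subsetIl _ _) nYB.
  by left.
by right.
Qed.

(** Reduction to a faithful irreducible action: take a minimal [B]-invariant subgroup of [N] not
    centralized by [R]; the kernel of [R] on it lies in ['Phi(R)] and is factored out. *)
Lemma Phi_chief_index_le (r : nat) R B N :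
    prime r -> r.-group R -> Phi_chief R B -> abelian N -> B \subset 'N(N) ->
    coprime #|N| #|R| -> ~~ (R \subset 'C(N)) ->
  #|R : 'Phi(R)| <= #|N|.
Proof.
move=> r_pr rR chR abN nNB coNR ncRN.
have [sRB nRB] := andP chR.1.
pose P (Y : {group gT}) := (B \subset 'N(Y)) && ~~ (R \subset 'C(Y)).
have [|N1 minN1 sN1N] := @mingroup_exists _ P N; first by rewrite /P nNB.
have [/andP[nN1B ncRN1] min] := mingroupP minN1.
have {min} minY (Y : {group gT}) : Y \subset N1 -> B \subset 'N(Y) ->
    ~~ (R \subset 'C(Y)) -> Y :=: N1.
  by move=> sYN nYB ncY; apply: min => //; rewrite /P nYB.
apply: leq_trans (subset_leq_card sN1N).
have {N abN nNB ncRN sN1N coNR minN1} [abN coNR] : abelian N1 /\ coprime #|N1| #|R|.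
  by split; [apply: abelianS abN | apply: coprimeSg coNR].
have nNR := subset_trans sRB nN1B.
have eN : [~: N1, R] = N1.
  apply: (minY [~: N1, R]%G); first by rewrite commg_subl.
    exact: normsR.
  apply: contra ncRN1 => cR.
  have : [~: N1, R] = 1.
    rewrite -(coprime_abel_cent_TI nNR coNR abN); apply/esym/setIidPl.
    by rewrite centsC.
  by move/commG1P; rewrite centsC.
(* By [eN], [R] has no nontrivial fixed point in [N1], so it cannot centralize [Y]. *)
have irrN (Y : {group gT}) : Y \subset N1 -> B \subset 'N(Y) -> Y :!=: 1 -> Y :=: N1.
  move=> sYN nYB ntY; apply: minY => //; apply: contra ntY => cRY.
  rewrite -subG1 -(coprime_abel_cent_TI nNR coNR abN) eN.
  by rewrite subsetI sYN centsC.
pose K := 'C_R(N1)%G.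
have nKB : B \subset 'N(K) by rewrite normsI // norms_cent.
have nKR := subset_trans sRB nKB.
have neKR : K :!=: R by apply: contra ncRN1 => /eqP/setIidPl.
have sKP : K \subset 'Phi(R).
  have [||/= <-|e] := chR.2 (K <*> 'Phi(R))%G (joing_subr _ _).
  - by rewrite join_subG subsetIl Phi_sub.
  - by rewrite normsY // gFnorm_trans.
  - exact: joing_subl.
  case/eqP: neKR; have := @Phi_nongen _ R K; rewrite joingC => /(_ e).
  by rewrite genGid.
have sKR : K \subset R := subsetIl _ _.
have [chq <-] : Phi_chief (R / K)%G (B / K)%G /\ #|R / K : 'Phi(R / K)| = #|R : 'Phi(R)|.
  by apply: (Phi_chief_quotient rR) => //; apply: subset_trans (subsetIr _ _) sKP.
have nKN : N1 \subset 'N(K) by apply: cents_norm; rewrite centsC subsetIr.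
have TI : K :&: N1 = 1.
  apply/trivgP; rewrite /= -(coprime_TIg coNR) setIC; apply: setIS; exact: sKR.
have oN : #|N1 / K| = #|N1| by rewrite -(card_isog (quotient_isog nKN TI)).
have ntN : N1 :!=: 1.
  by apply: contraNneq ncRN1 => ->; rewrite centsC sub1G.
rewrite -oN; apply: (@Phi_chief_irr_index_le _ r (R / K)%G (B / K)%G (N1 / K)%G) => //=.
- exact: quotient_pgroup.
- exact: quotient_abelian.
- exact: quotient_norms.
- exact: coprime_morph.
- by rewrite trivg_card1 oN -trivg_card1.
- by rewrite -subG1 quotient_sub1 //; apply: contra neKR => sRK; rewrite eqEsubset sKR.
- apply/trivgP/subsetP=> xb /setIP[/morphimP[x nKx Rx exb] /centP cxb].
  rewrite exb inE; apply/eqP/coset_id; rewrite inE Rx; apply/centP=> w Nw.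
  have nKw := subsetP nKN w Nw; apply/commgP.
  rewrite -in_set1 -[[set 1]]TI inE; apply/andP; split.
    apply: coset_idr; first by rewrite groupR.
    rewrite morphR //= -exb; apply/eqP/commgP/cxb; exact: mem_quotient.
  by rewrite commgEr groupM // memJ_norm ?groupV // (subsetP nNR).
move=> Y sYN nYB ntY; have eY := quo_preI sYN.
rewrite -[LHS]eY; apply: (congr1 (fun A : {set gT} => A / K)).
apply: (irrN (N1 :&: coset K @*^-1 Y)%G).
- exact: subsetIl.
- by rewrite normsI ?norm_cosetpre.
by apply: contra ntY => /eqP e1; rewrite -eY e1 quotient1.
Qed.

End QuoPre.

(** * Coverings *)

Lemma is_coveringP (gT : finGroupType) (G : {group gT}) (F : {set {group gT}}) :
  reflect ((forall H, H \in F -> H \proper G) /\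
           (forall x, x \in G -> exists2 H, H \in F & x \in gval H))
          (is_covering G F).
Proof.
apply: (iffP andP) => [[/forall_inP prF /eqP covF] | [prF covF]]; split=> //.
- by move=> x; rewrite -{1}covF => /bigcupP.
- exact/forall_inP.
rewrite eqEsubset; apply/andP; split.
  by apply/bigcupsP=> H /prF/proper_sub.
by apply/subsetP=> x /covF[H FH Hx]; apply/bigcupP; exists H.
Qed.

Lemma is_primary_coveringP (gT : finGroupType) (G : {group gT}) (F : {set {group gT}}) :
  reflect ((forall H, H \in F -> H \proper G) /\
           (forall x, x \in G -> p_group <[x]> -> exists2 H, H \in F & x \in gval H))
          (is_primary_covering G F).
Proof.
apply: (iffP andP) => [[/forall_inP prF /subsetP covF] | [prF covF]]; split=> //.
- by move=> x Gx px; apply/bigcupP/covF; rewrite inE Gx.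
- exact/forall_inP.
apply/subsetP=> x; rewrite inE => /andP[Gx px].
by have [H FH Hx] := covF x Gx px; apply/bigcupP; exists H.
Qed.

Arguments is_coveringP {gT G F}.
Arguments is_primary_coveringP {gT G F}.

Definition coverable (gT : finGroupType) (G : {group gT}) n :=
  exists2 F, is_covering G F & #|F| <= n.

Lemma coverable_leq (gT : finGroupType) (G : {group gT}) m n :
  m <= n -> coverable G m -> coverable G n.
Proof. by move=> le [F covF leF]; exists F; rewrite ?(leq_trans leF). Qed.

(** Serves both for preimages under a quotient map and for the subgroups [H <*> N] with [H] in a
    complement of [N]. *)
Lemma coverable_pull (aT gT : finGroupType) (A : {group aT}) (G : {group gT})
    (f : {group aT} -> {group gT}) n :
    (forall H : {group aT}, H \proper A -> f H \proper G) ->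
    (forall x, x \in G -> exists2 a, a \in A &
       forall H : {group aT}, a \in H -> x \in f H) ->
  coverable A n -> coverable G n.
Proof.
move=> prf covf [F /is_coveringP[prF covF] leF].
exists (f @: F); last exact: leq_trans (leq_imset_card _ _) leF.
apply/is_coveringP; split=> [_ /imsetP[H FH ->] | x /covf[a Aa fa]].
  by apply: prf; apply: prF.
have [H FH Ha] := covF a Aa; exists (f H); last exact: fa.
exact: imset_f.
Qed.

Section Cover.
Variable gT : finGroupType.
Implicit Types (G H K M N T : {group gT}).

Lemma coverable_quotient G K n :
  K <| G -> coverable (G / K)%G n -> coverable G n.
Proof.
move=> nsKG cQ; have nKG := normal_norm nsKG.
apply: (coverable_pull (f := fun H : {group coset_of K} => (coset K @*^-1 H)%G) _ _ cQ).
  move=> H ltH.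
  by rewrite /= -(quotientGK nsKG) cosetpre_proper.
move=> x Gx; exists (coset K x) => [|H Hx]; first exact: mem_quotient.
by rewrite mem_morphpre // (subsetP nKG).
Qed.

Lemma coverable_complement G M N n :
    G \subset 'N(N) -> M * N = G -> M :&: N = 1 ->
  coverable M n -> coverable G n.
Proof.
move=> nNG defG tiMN.
have sMG : M \subset G by rewrite -defG mulG_subl.
apply: (coverable_pull (f := fun H => (H <*> N)%G)) => [H ltH | x].
  have sHM := proper_sub ltH.
  have nNH : H \subset 'N(N) := subset_trans (subset_trans sHM sMG) nNG.
  rewrite /= norm_joinEl // properEcard -{1}defG mulSg //= -defG.
  rewrite !TI_cardMg //; first by rewrite ltn_pmul2r // proper_card.
  by apply/trivgP; rewrite -tiMN setSI.
rewrite -{1}defG => /mulsgP[m k Mm Nk ->]; exists m => // H Hm.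
by rewrite groupM // mem_gen // inE ?Hm ?Nk ?orbT.
Qed.

(* Outside 'C_G(N) every element acts on N without fixed points, so that its *)
(* coset of N is a single N-class and meets M.                               *)
Lemma coverable_minnormal G M N :
    minnormal N G -> abelian N -> M * N = G -> M :&: N = 1 ->
    G^`(1) \subset 'C(N) -> ~~ (G \subset 'C(N)) ->
  coverable G #|N|.+1.
Proof.
move=> minN abN defG tiMN sG'C ncGN.
have [/andP[ntN nNG] min] := mingroupP minN.
have sNG : N \subset G by rewrite -defG mulG_subr.
have sMG : M \subset G by rewrite -defG mulG_subl.
have prM : M \proper G.
  rewrite properEcard sMG -defG TI_cardMg //.
  by rewrite ltn_Pmulr // cardG_gt1.
pose F := ('C_G(N))%G |: [set (M :^ x)%G | x in N].
exists F; last first.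
  by rewrite cardsU1 addnC -addn1 leq_add ?leq_imset_card // leq_b1.
apply/is_coveringP; split=> [H /setU1P[-> | /imsetP[x Nx ->]] | g Gg].
- by rewrite properE subsetIl /=; apply: contra ncGN; rewrite subsetI subxx.
- by rewrite /= -(conjGid (subsetP sNG x Nx)) properJ.
have [cg | ncg] := boolP (g \in 'C(N)).
  by exists 'C_G(N)%G; rewrite ?setU11 // inE Gg.
have c1 : 'C_N[g] = 1.
  apply/eqP; apply: contraR ncg => ntC; have <- : 'C_N[g] = N.
    apply: (min 'C_N[g]%G); rewrite ?subsetIl // ntC.
    apply/subsetP=> h Gh; rewrite inE; apply/subsetP=> _ /imsetP[w /setIP[Nw cgw] ->].
    have Nwh : w ^ h \in N by rewrite memJ_norm // (subsetP nNG).
    rewrite inE Nwh; apply/cent1P.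
    have cgh : commute (w ^ h) (g ^ h) by rewrite /commute -!conjMg [_ * _](cent1P cgw).
    have cR : commute (w ^ h) [~ g, h]^-1.
      apply/commuteV/commute_sym; apply: (centP (subsetP sG'C _ _) _ Nwh).
      exact: mem_commg.
    have -> : g = g ^ h * [~ g, h]^-1 by rewrite commgEl invMg invgK mulKVg.
    exact: commuteM.
  by apply/centP=> w /setIP[_ /cent1P].
have eclass : g ^: N = g *: N.
  apply/eqP; rewrite eqEcard card_lcoset; apply/andP; split.
    apply/subsetP=> _ /imsetP[w Nw ->]; rewrite mem_lcoset -commgEl commgEr.
    by rewrite groupM // memJ_norm ?groupV // (subsetP nNG).
  by rewrite -index_cent1 c1 indexg1.
have /mulsgP[m k Mm Nk eg] : g \in M * N by rewrite defG.
have : m \in g ^: N by rewrite eclass mem_lcoset eg invMg mulgKV groupV.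
case/imsetP=> w Nw em; exists (M :^ w^-1)%G; last by rewrite mem_conjgV -em.
by apply/setU1P; right; apply: imset_f; rewrite groupV.
Qed.

(** Modulo [M1 :&: M2] the group is elementary abelian of order p ^ 2, and its p + 1 subgroups of
    order p cover it. *)
Lemma prime_index_family (p : nat) G M1 M2 :
    prime p -> M1 <| G -> M2 <| G -> #|G : M1| = p -> #|G : M2| = p ->
    M1 :!=: M2 ->
  exists X : {set {group gT}}, [/\ is_covering G X, #|X| = p.+1 &
    forall T, T \in X -> M1 :&: M2 \subset T /\ #|G : T| = p].
Proof.
move=> p_pr nsM1 nsM2 i1 i2 neM; set K := (M1 :&: M2)%G.
have nsK : K <| G by apply: normalI.
have [sKG nKG] := andP nsK.
have sK1 : K \subset M1 := subsetIl _ _.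
have sK2 : K \subset M2 := subsetIr _ _.
have [s1 s2] := (normal_sub nsM1, normal_sub nsM2).
have defG : M1 * M2 = G.
  have max1 : maximal M1 G by rewrite p_index_maximal ?i1.
  have [_ mx] := maxgroupP max1.
  rewrite -norm_joinEr ?(subset_trans s2) ?normal_norm //.
  apply/eqP; rewrite eqEproper join_subG s1 s2 /=; apply/negP=> lt.
  have e := mx _ lt (joing_subl _ _); case/eqP: neM; apply/eqP.
  rewrite eq_sym eqEcard -{1}e joing_subr /=.
  by rewrite -(leq_pmul2r (prime_gt0 p_pr)) -{1}i1 -i2 !Lagrange.
have eK := mul_cardG M1 M2; rewrite defG in eK.
have o1 : #|M1 / K| = p.
  rewrite card_quotient ?(subset_trans s1) //; apply/eqP.
  rewrite -(eqn_pmul2l (cardG_gt0 K)) Lagrange // -(eqn_pmul2r (cardG_gt0 M2)) eK.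
  by rewrite -(Lagrange s2) i2 mulnC mulnA mulnAC eqxx.
have o2 : #|M2 / K| = p.
  rewrite card_quotient ?(subset_trans s2) //; apply/eqP.
  rewrite -(eqn_pmul2l (cardG_gt0 K)) Lagrange // -(eqn_pmul2l (cardG_gt0 M1)) eK.
  by rewrite -(Lagrange s1) i1 mulnC mulnA mulnAC mulnC mulnA eqxx.
have ti : (M1 / K) :&: (M2 / K) = 1.
  by rewrite -quotientIG // trivg_quotient.
have defQ : (M1 / K) \x (M2 / K) = G / K.
  rewrite dprodE //; first by rewrite -quotientMl ?(subset_trans s1) // defG.
  apply/commG1P/trivgP; rewrite -ti subsetI commg_subl commg_subr.
  rewrite !quotient_norms //.
    by apply: subset_trans s1 (normal_norm nsM2).
  by apply: subset_trans s2 (normal_norm nsM1).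
have oQ : #|G / K| = (p ^ 2)%N by rewrite -(dprod_card defQ) o1 o2.
have abQ : p.-abelem (G / K).
  by rewrite (dprod_abelem p defQ) !prime_abelem.
have EQ : (G / K)%G \in 'E_p^2(G / K).
  by apply/pnElemP; rewrite subxx abQ oQ pfactorK.
pose X := [set (coset K @*^-1 H)%G | H in 'E_p^1(G / K)].
have injX : {in 'E_p^1(G / K) &, injective (fun H : {group coset_of K} => (coset K @*^-1 H)%G)}.
  move=> H1 H2 _ _ /(congr1 (@gval _)) /= e; apply: val_inj => /=.
  by rewrite -[LHS](cosetpreK H1) -[RHS](cosetpreK H2) e.
exists X; split; last 2 first.
- by rewrite card_in_imset // (card_p1Elem_p2Elem EQ).
- move=> _ /imsetP[H /pnElemPcard[sHQ _ oH] ->]; split; first exact: sub_cosetpre.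
  have iH : #|G / K : H| = p.
    apply/eqP; rewrite -(eqn_pmul2l (cardG_gt0 H)) Lagrange // oQ oH.
    by rewrite expn1 expnS expn1.
  have sHG : coset K @*^-1 H \subset G by rewrite sub_cosetpre_quo.
  have sKH : G :&: K \subset coset K @*^-1 H.
    by apply: subset_trans (subsetIr G K) _; apply: sub_cosetpre.
  by rewrite -iH -[in RHS](cosetpreK H) index_quotient_eq.
apply/is_coveringP; split=> [_ /imsetP[H /pnElemPcard[sHQ _ oH] ->] | x Gx].
  rewrite /= -(quotientGK nsK) cosetpre_proper properEcard sHQ oQ oH.
  by rewrite ltn_exp2l // prime_gt1.
have Qx := mem_quotient K Gx.
suff [H EH Hx] : exists2 H : {group coset_of K}, H \in 'E_p^1(G / K) & coset K x \in H.
  exists (coset K @*^-1 H)%G; first exact: imset_f.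
  by rewrite mem_morphpre // (subsetP nKG).
have [x1 | ntx] := eqVneq (coset K x) 1.
  exists (M1 / K)%G; last by rewrite x1 group1.
  by rewrite p1ElemE // !inE quotientS //= o1 eqxx.
exists <[coset K x]>%G; last exact: cycle_id.
by rewrite p1ElemE // !inE cycle_subG Qx -orderE (abelem_order_p abQ) ?eqxx.
Qed.

End Cover.

(** * Chief factors of solvable groups *)

Section Chief.
Variable gT : finGroupType.
Implicit Types (B D E G L M N R X : {group gT}).

(** [B] is a minimal supplement of [L] in [M] and [R] a Sylow r-subgroup of [B :&: D]; minimality
    makes [R] normal in [B] and [R :&: L = 'Phi(R)], so that [R / 'Phi(R)] is a copy of [D / L]. *)
Lemma chief_supplement (r : nat) M L D :
    prime r -> D <| M -> L <| M -> L \proper D ->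
    (forall X, L \subset X -> X \subset D -> M \subset 'N(X) -> X :=: L \/ X :=: D) ->
    r.-abelem (D / L) -> r^'.-group (M / D) ->
  exists R B, [/\ B \subset M, r.-group R, R :!=: 1, Phi_chief R B & #|D / L| = #|R : 'Phi(R)|].
Proof.
move=> r_pr nsDM nsLM ltLD chX abDL r'MD.
have [[sDM nDM] [sLM nLM]] := (andP nsDM, andP nsLM).
have sLD := proper_sub ltLD.
have [|B minB sBM] := @mingroup_exists _ (fun B => (B \subset M) && (M \subset B * L)) M.
  by rewrite subxx mulG_subl.
have [/andP[_ defM] min] := mingroupP minB.
have {min} minB' (T : {group gT}) : T \subset B -> M \subset T * L -> T :=: B.
  by move=> sTB sMT; apply: min => //; rewrite (subset_trans sTB).
have nLB := subset_trans sBM nLM.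
pose H := (B :&: D)%G.
have defD : H * L = D.
  rewrite /= setIC group_modr //; apply/setIidPl.
  exact: subset_trans sDM defM.
have [R sylR] := Sylow_exists r H.
have [sRH rR _] := and3P sylR.
have sRB : R \subset B := subset_trans sRH (subsetIl _ _).
have sRD : R \subset D := subset_trans sRH (subsetIr _ _).
have nLR := subset_trans sRB nLB.
have rDL : r.-group (D / L) := abelem_pgroup abDL.
have qH : H / L = D / L by rewrite -defD quotientMidr.
have qR : R / L = D / L.
  have := quotient_pHall nLR sylR; rewrite /= qH => hall.
  by apply: pHall_id hall _.
have defDR : R * L = D.
  apply/eqP; rewrite eqEsubset mul_subG //= (normC nLR) -quotientSK ?qR //.
  exact: subset_trans sDM nLM.
have nsHB : H <| B by rewrite /normal subsetIl normsI ?normG // (subset_trans sBM).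
have defH : (R * (L :&: B))%g = H by rewrite group_modl // defDR setIC.
have nUB : B \subset 'N(L :&: B) by rewrite normsI ?normG.
(* By the Frattini argument [B] is the product of [L :&: B] and ['N_B(R)], so this normalizer still
   supplements [L]. *)
have nRB : B \subset 'N(R).
  have := Frattini_arg nsHB sylR; rewrite -defH => defB.
  apply/setIidPl; apply: (minB' 'N_B(R)%G); first exact: subsetIl.
  apply: subset_trans defM _; rewrite -{1}defB.
  rewrite (normC (subset_trans sRB nUB)) -!mulgA.
  have sRN : R \subset 'N_B(R) by rewrite subsetI sRB normG.
  rewrite (mulgA R) (mulSGid sRN).
  have nLN : 'N_B(R) \subset 'N(L) := subset_trans (subsetIl _ _) nLB.
  by rewrite (normC nLN) mulgA (mulSGid (subsetIl L B)).
have nsRB : R <| B by apply/andP.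
have sPL : 'Phi(R) \subset R :&: L.
  rewrite subsetI Phi_sub -quotient_sub1 ?(subset_trans (Phi_sub R)) //.
  by rewrite (quotient_Phi rR nLR) /= qR subG1 (trivg_Phi rDL).
have nPB : B \subset 'N('Phi(R)) := gFnorm_trans _ nRB.
have nPR : R \subset 'N('Phi(R)) := subset_trans sRB nPB.
have sUR : R :&: L \subset R := subsetIl _ _.
have abR : r.-abelem (R / 'Phi(R)) := Phi_quotient_abelem rR.
have r'BR : r^'.-nat #|B : R|.
  rewrite -(Lagrange_index (subsetIl B D) sRH) pnatM; apply/andP; split; last by case/and3P: sylR.
  rewrite indexgI -card_quotient ?(subset_trans sBM) //.
  exact: pgroupS (quotientS D sBM) r'MD.
(* [(R :&: L) / 'Phi(R)] has a complement in [R / 'Phi(R)], hence by Gaschutz one in [B / 'Phi(R)],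
   as [#|B : R|] is prime to r. The preimage of the latter supplements [L], so it is [B]. *)
have sULP : R :&: L \subset 'Phi(R).
  have splR : [splits R / 'Phi(R), over (R :&: L) / 'Phi(R)].
    by rewrite (abelem_splits abR) ?quotientS.
  have splB : [splits B / 'Phi(R), over (R :&: L) / 'Phi(R)].
    have nsU : (R :&: L) / 'Phi(R) <| B / 'Phi(R).
      by rewrite quotient_normal // /normal (subset_trans sUR sRB) normsI.
    have abU : abelian ((R :&: L) / 'Phi(R)).
      by apply: abelianS (quotientS _ sUR) (abelem_abelian abR).
    rewrite (Gaschutz_split nsU (quotientS _ sUR) (quotientS _ sRB) abU) //=.
    rewrite index_quotient_eq ?(subset_trans (subsetIr _ _)) ?Phi_sub //.
    apply: (@pnat_coprime r) => //.
    by apply: pgroupS (quotientS _ sUR) (abelem_pgroup abR).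
  have /splitsP[T /complP[tiT defT]] := splB.
  have sTB : T \subset B / 'Phi(R) by rewrite -defT mulG_subr.
  pose T1 := (B :&: coset 'Phi(R) @*^-1 T)%G.
  have qT1 : T1 / 'Phi(R) = T by apply: quo_preI.
  have sPT : 'Phi(R) \subset T1 by rewrite subsetI (subset_trans (Phi_sub R)) //= sub_cosetpre.
  have sBT : B \subset (R :&: L) * T1.
    rewrite -(mulSGid sPL) -mulgA -quotientSK //.
    by rewrite quotientMl ?(subset_trans sUR) // qT1 defT.
  have eT : T1 :=: B.
    apply: minB'; first exact: subsetIl.
    apply: subset_trans defM _; apply: subset_trans (mulSg _ sBT) _.
    have nLT : T1 \subset 'N(L) := subset_trans (subsetIl _ _) nLB.
    rewrite -mulgA (normC nLT) mulgA (mulSGid (subsetIr _ _)) //.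
  rewrite -quotient_sub1 ?(subset_trans sUR) // -tiT subsetI subxx -qT1 /= eT.
  exact: quotientS (subset_trans sUR sRB).
have eP : R :&: L = 'Phi(R) by apply/eqP; rewrite eqEsubset sULP.
exists R, B; split=> //.
- apply: contraTneq ltLD => R1; rewrite -defDR R1 mul1g properxx //.
- split=> // X sPX sXR nXB.
  have nLX := subset_trans sXR nLR.
  have eXL := norm_joinEl nLX.
  have [|||/= e|/= e] := chX (X <*> L)%G; first exact: joing_subr.
  - by rewrite join_subG sLD (subset_trans sXR).
  - apply: subset_trans defM _; rewrite mul_subG //=; first exact: normsY.
    exact: subset_trans (joing_subr X L) (normG _).
  - left; apply/eqP; rewrite eqEsubset sPX andbT -eP subsetI sXR /=.
    by rewrite -e joing_subl.
  right; apply/eqP; rewrite eqEsubset sXR /=.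
  have : R \subset X * L by rewrite -eXL e.
  move/setIidPl <-; rewrite setIC -group_modl // mul_subG //.
  by rewrite setIC eP.
by rewrite -qR card_quotient // -eP indexgI.
Qed.

(** Otherwise a chief factor [Y / Z] of [M] lies in [C / Z]; as [Z] is central in [Y], the group [Y]
    is nilpotent, so it is contained in ['F(M)] and in [Z]. *)
Lemma sub_cent_Fitting M : solvable M -> 'C_M('F(M)) \subset 'F(M).
Proof.
move=> solM; set F := 'F(M); set C := 'C_M(F); apply: contraT => nsCF.
have nsFM : F <| M := Fitting_normal M.
have nsCM : C <| M by rewrite /normal subsetIl normsI ?normG ?norms_cent ?normal_norm.
pose Z := (C :&: F)%G.
have nsZM : Z <| M by apply: normalI.
have [sZM nZM] := andP nsZM.
have nZC : C \subset 'N(Z) := subset_trans (normal_sub nsCM) nZM.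
have ntCZ : C / Z != 1.
  rewrite -subG1 quotient_sub1 //; apply: contra nsCF => sCZ.
  exact: subset_trans sCZ (subsetIr _ _).
have [X minX sXC] := minnormal_exists ntCZ (quotient_norms Z (normal_norm nsCM)).
have solMZ : solvable (M / Z) by apply: quotient_sol.
have sXM := subset_trans sXC (quotientS Z (normal_sub nsCM)).
have [nXM ntX abX] := minnormal_solvable minX sXM solMZ.
pose Y := (C :&: coset Z @*^-1 X)%G.
have qY : Y / Z = X by apply: quo_preI.
have sYC : Y \subset C := subsetIl _ _.
have nsYM : Y <| M.
  rewrite /normal (subset_trans sYC (normal_sub nsCM)).
  by apply: normsI; [apply: normal_norm | apply: norm_cosetpre].
have nZY := subset_trans sYC nZC.
have sY'Z : Y^`(1) \subset Z.
  by apply: der1_min => //; rewrite /= qY; by case/is_abelemP: abX => q _ /abelem_abelian.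
have nilY : nilpotent Y.
  rewrite -quotient_center_nil; apply/abelian_nil/sub_der1_abelian.
  rewrite subsetI der_sub; apply: subset_trans sY'Z _.
  rewrite centsC; apply: subset_trans (subset_trans sYC (subsetIr M _)) _.
  by apply: centS; apply: subsetIr.
case/negP: ntX; rewrite -qY -subG1 quotient_sub1 // subsetI sYC.
exact: Fitting_max.
Qed.

End Chief.

(** * Chief factors of a faithful irreducible solvable group *)

Section Module.
Variable gT : finGroupType.
Implicit Types (B D E G L M N R X : {group gT}).

(** Coprime fixed points lift, so ['C_E(R)] covers [E / 'Phi(E)], and ['Phi(E)] consists of
    nongenerators. *)
Lemma coprime_cent_Frattini R E : solvable E -> R \subset 'N(E) -> coprime #|E| #|R| ->
  R / 'Phi(E) \subset 'C(E / 'Phi(E)) -> R \subset 'C(E).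
Proof.
move=> solE nER coER cRE.
have nPR : R \subset 'N('Phi(E)) := gFnorm_trans _ nER.
have := coprime_quotient_cent (Phi_sub E) nPR coER solE.
have -> : 'C_(E / 'Phi(E))(R / 'Phi(E)) = E / 'Phi(E).
  by apply/setIidPl; rewrite centsC.
move=> eC; have sE : E \subset 'Phi(E) * 'C_E(R).
  by rewrite -quotientSK ?gFnorm // eC.
have := @Phi_nongen _ E 'C_E(R); rewrite genGid => eE.
rewrite centsC; apply/setIidPl/eE; apply/eqP; rewrite eqEsubset.
by rewrite join_subG Phi_sub subsetIl (subset_trans sE) // mulG_subG joing_subl joing_subr.
Qed.

(* If N is an r-group, then R acts nontrivially on a chief factor E / Phi(E), *)
(* where the r'-group E <= 'F(M) acts nontrivially on N; the coprime case     *)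
(* applies twice.                                                             *)
Lemma Phi_chief_module_le (r : nat) M N R B :
    solvable M -> minnormal N M -> abelian N -> 'C_M(N) = 1 ->
    prime r -> B \subset M -> r.-group R -> R :!=: 1 -> Phi_chief R B ->
  #|R : 'Phi(R)| <= #|N|.
Proof.
move=> solM minN abN cMN r_pr sBM rR ntR chR.
have [/andP[ntN nNM] min] := mingroupP minN.
have [sRB nRB] := andP chR.1.
have sRM := subset_trans sRB sBM.
have nNB := subset_trans sBM nNM.
have ntC X : X \subset M -> X :!=: 1 -> ~~ (X \subset 'C(N)).
  move=> sXM; apply: contra => cX; rewrite -subG1 -cMN subsetI sXM //.
have [_ _ /is_abelemP[s s_pr abelN]] := minnormal_solvable minN (subxx N) (abelian_sol abN).
have sN := abelem_pgroup abelN.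
have [ers | ners] := eqVneq s r; last first.
  apply: (Phi_chief_index_le r_pr rR chR) => //; last exact: ntC.
  by rewrite (pnat_coprime sN) // (pi_pnat rR) // !inE eq_sym.
rewrite {}ers {s s_pr abelN} in sN.
(* A normal r-subgroup has nontrivial fixed points on the r-group [N], hence centralizes [N] by
   irreducibility and is trivial by faithfulness. *)
have Or1 : 'O_r(M) = 1.
  set O := 'O_r(M); have nsOM : O <| M := pcore_normal r M.
  have [sOM nOM] := andP nsOM.
  have nNO := subset_trans sOM nNM.
  have rNO : r.-group (N <*> O).
    by rewrite norm_joinEr // pgroupM sN pcore_pgroup.
  have ntCN : 'C_N(O) != 1.
    have := meet_center_nil (pgroup_nil rNO) _ ntN.
    rewrite /normal joing_subl join_subG normG nNO => /(_ isT).
    apply: subG1_contra; apply: setIS; apply: subset_trans (subsetIr _ _) _.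
    by apply: centS; apply: joing_subr.
  have eN : 'C_N(O) = N.
    apply: (min 'C_N(O)%G); last exact: subsetIl.
    by rewrite ntCN normsI // norms_cent.
  apply/eqP; apply: contraT => /(ntC 'O_r(M)%G sOM) /negP[].
  by rewrite centsC -eN subsetIr.
(* Otherwise [R] would lie in ['F(M)], hence in ['O_r(M)], which is trivial. *)
have ncRF : ~~ (R \subset 'C('F(M))).
  apply: contra ntR => cRF; rewrite -subG1 -Or1.
  have sRF : R \subset 'F(M).
    by apply: subset_trans (sub_cent_Fitting solM); rewrite subsetI sRM.
  have sRO : R \subset 'O_r('F(M)).
    by rewrite (sub_Hall_pcore (nilpotent_pcore_Hall r (Fitting_nil M)) sRF).
  apply: subset_trans sRO _; apply: pcore_max; first exact: pcore_pgroup.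
  by apply: gFnormal_trans; apply: Fitting_normal.
have [t [t_pr netr ncRO]] : exists t : nat, [/\ prime t, t != r & ~~ (R \subset 'C('O_t(M)))].
  move: ncRF; rewrite FittingEgen cent_gen => ncR.
  have [/existsP[t /andP[/andP[pit ntr] nc]] | none] := boolP [exists t : 'I_#|M|.+1,
    (((t : nat) \in \pi(M)) && ((t : nat) != r)) && ~~ (R \subset 'C('O_t(M)))].
    exists t; split=> //; by move: pit; rewrite mem_primes => /andP[].
  case/negP: ncR; rewrite centsC; apply/bigcupsP=> t pit.
  rewrite centsC; apply: contraR none => nc; apply/existsP; exists t.
  rewrite pit nc andbT; apply: contraNneq nc => ->.
  by rewrite Or1 centsC sub1G.
pose Q E := (B \subset 'N(E)) && ~~ (R \subset 'C(E)).
have [|E minE sEO] := @mingroup_exists _ Q 'O_t(M)%G.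
  by rewrite /Q /= ncRO (subset_trans sBM) ?gFnorm.
have [/andP[nEB ncRE] minE'] := mingroupP minE.
(* This minimality is what makes [E / 'Phi(E)] a chief factor of [B <*> E]. *)
have cRX X : X \proper E -> B \subset 'N(X) -> R \subset 'C(X).
  move=> ltXE nXB; apply: contraT => nc; case/andP: (ltXE) => sXE /negP[].
  by rewrite (minE' X) // /Q nXB.
have sEM : E \subset M := subset_trans sEO (pcore_sub t M).
have tE : t.-group E := pgroupS sEO (pcore_pgroup t M).
have nER := subset_trans sRB nEB.
have coER : coprime #|E| #|R|.
  by rewrite (pnat_coprime tE) // (pi_pnat rR) // !inE eq_sym.
have nPB : B \subset 'N('Phi(E)) := gFnorm_trans _ nEB.
have nPR := subset_trans sRB nPB.
have nPE : E \subset 'N('Phi(E)) := gFnorm _ _.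
have solE : solvable E := solvableS sEM solM.
have ncRq : ~~ (R / 'Phi(E) \subset 'C(E / 'Phi(E))).
  by apply: contra ncRE; apply: coprime_cent_Frattini.
have abE : abelian (E / 'Phi(E)) := abelem_abelian (Phi_quotient_abelem tE).
have nEq := quotient_norms 'Phi(E) nER.
have coq : coprime #|E / 'Phi(E)| #|R / 'Phi(E)| by apply: coprime_morph.
have tiC := coprime_abel_cent_TI nEq coq abE.
have eE : [~: E / 'Phi(E), R / 'Phi(E)] = E / 'Phi(E).
  pose Z := (E :&: coset 'Phi(E) @*^-1 [~: E / 'Phi(E), R / 'Phi(E)])%G.
  have sEq : [~: E / 'Phi(E), R / 'Phi(E)] \subset E / 'Phi(E) by rewrite commg_subl.
  have qZ : Z / 'Phi(E) = [~: E / 'Phi(E), R / 'Phi(E)].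
    exact: (@quo_preI _ 'Phi(E)%G E [~: E / 'Phi(E), R / 'Phi(E)]%G).
  have nZB : B \subset 'N(Z).
    rewrite normsI //; apply: (@norm_cosetpre _ 'Phi(E)%G B [~: E / 'Phi(E), R / 'Phi(E)]%G) => //.
    by rewrite normsR ?quotient_norms.
  have [eZ | neZ] := eqVneq (Z : {set gT}) E; first by rewrite -qZ eZ.
  have cRZ : R \subset 'C(Z) by apply: cRX nZB; rewrite properEneq neZ subsetIl.
  case/negP: ncRq; rewrite centsC; apply/commG1P.
  rewrite -tiC -qZ; apply/esym/setIidPl; rewrite centsC.
  exact: quotient_cents.
have chE : Phi_chief E (B <*> E)%G.
  split=> [|X sPX sXE]; first by rewrite /normal joing_subr join_subG nEB normG.
  rewrite join_subG => /andP[nXB _].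
  have [eX | neX] := eqVneq (X : {set gT}) E; [by right | left].
  have cXR : R \subset 'C(X) by apply: cRX nXB; rewrite properEneq neX.
  apply/eqP; rewrite eqEsubset sPX andbT -quotient_sub1 ?(subset_trans sXE) //.
  by rewrite -tiC eE subsetI quotientS // quotient_cents // centsC.
have le1 : #|E : 'Phi(E)| <= #|N|.
  apply: (Phi_chief_index_le t_pr tE chE) => //.
  - by rewrite join_subG nNB (subset_trans sEM).
  - by rewrite (pnat_coprime sN) // (pi_pnat tE) // !inE.
  apply: ntC => //; apply: contraNneq ncRE => ->.
  by rewrite centsC sub1G.
apply: leq_trans le1; rewrite -(card_quotient nPE).
have tiRP : R :&: 'Phi(E) \subset 'Phi(R).
  by rewrite setIC (coprime_TIg (coprimeSg (Phi_sub E) coER)) sub1G.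
have [chq <-] := @Phi_chief_quotient _ r R B 'Phi(E)%G rR chR nPB tiRP.
apply: (Phi_chief_index_le r_pr _ chq) => //; first exact: quotient_pgroup.
exact: quotient_norms.
Qed.

End Module.

(** * Upper bounds *)

(** An element outside one maximal subgroup generates a proper subgroup, which lies in a second
    one. *)
Lemma coverable_pgroup (gT : finGroupType) (p : nat) (A : {group gT}) :
  prime p -> p.-group A -> ~~ cyclic A -> coverable A p.+1.
Proof.
move=> p_pr pA ncA.
have ntA : A :!=: 1 by apply: contraNneq ncA => ->; apply: cyclic1.
have ex (H : {group gT}) : H \proper A -> exists2 M : {group gT}, maximal M A & H \subset M.
  move=> ltH; have [e | //] := maximal_exists (proper_sub ltH).
  by rewrite e properxx in ltH.
have [|M1 max1 _] := ex 1%G; first by rewrite proper1G.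
have [_ [x Ax nM1x]] := properP (maxgroupp max1).
have [|M2 max2 sxM2] := ex <[x]>%G.
  rewrite properEneq cycle_subG Ax andbT; apply: contraNneq ncA => <-.
  exact: cycle_cyclic.
have ne : M1 :!=: M2.
  by apply: contraNneq nM1x => ->; rewrite -cycle_subG.
have [X [covX oX _]] := prime_index_family p_pr (p_maximal_normal pA max1)
  (p_maximal_normal pA max2) (p_maximal_index pA max1) (p_maximal_index pA max2) ne.
by exists X; rewrite ?oX.
Qed.

Lemma coverable_irreducible (gT : finGroupType) (M N : {group gT}) :
    solvable M -> minnormal N M -> abelian N -> 'C_M(N) = 1 ->
    p_group (M / M^`(1)) -> ~~ abelian M ->
  coverable M #|N|.+1.
Proof.
move=> solM minN abN cMN /p_groupP[p p_pr pA] nabM.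
have [/andP[ntN nNM] _] := mingroupP minN.
have [cycA | ncA] := boolP (cyclic (M / M^`(1))); last first.
  apply: (@coverable_leq _ _ p.+1); last first.
    apply: (@coverable_quotient _ M M^`(1)%G); first exact: der_normal.
    exact: coverable_pgroup.
  (* p <= [#|N|]: by faithfulness an element of order p moves some [w] in [N], whose orbit has
     length p. *)
  rewrite ltnS; have pM : p %| #|M|.
    apply: dvdn_trans (dvdn_quotient M M^`(1)).
    have [|//] := pgroup_pdiv pA.
    by apply: contraNneq ncA => ->; apply: cyclic1.
  have [x Mx ox] := Cauchy p_pr pM.
  have /subsetPn[w Nw ncw] : ~~ (N \subset 'C[x]).
    apply/negP=> cNx; have : x \in 'C_M(N) by rewrite inE Mx -sub_cent1.
    by rewrite cMN => /set1P x1; move: p_pr; rewrite -ox x1 order1.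
  have sxM : <[x]> \subset M by rewrite cycle_subG.
  apply: leq_trans (_ : #|w ^: <[x]>| <= _); last first.
    by rewrite subset_leq_card // class_sub_norm // (subset_trans sxM).
  rewrite -index_cent1 (@prime_TIg _ <[x]>%G 'C[w]%G); first by rewrite indexg1 -orderE ox.
    by rewrite -orderE ox.
  by rewrite cycle_subG cent1C.
have ntM' : M^`(1) != 1 by apply: contra nabM => /eqP/derG1P.
pose Q (L : {group gT}) := (L \proper M^`(1)) && (M \subset 'N(L)).
have [|L maxL _] := @maxgroup_exists _ Q 1%G.
  by rewrite /Q proper1G ntM' norms1.
have [/andP[ltL nLM] mx] := maxgroupP maxL.
have nsDM : M^`(1) <| M := der_normal 1 M.
have [sDM nDM] := andP nsDM.
have sLD := proper_sub ltL; have sLM := subset_trans sLD sDM.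
have nsLM : L <| M by apply/andP.
have nLD := subset_trans sDM nLM.
have minq : minnormal (M^`(1) / L) (M / L) by apply: maxnormal_minnormal.
have solq : solvable (M / L) by apply: quotient_sol.
have [nDq ntDq /is_abelemP[r r_pr abq]] := minnormal_solvable minq (quotientS L sDM) solq.
have rq := abelem_pgroup abq.
have [x Mx defM] : exists2 x, x \in M & M \subset M^`(1) * <[x]>.
  have /cyclicP[xb defA] := cycA.
  have /morphimP[x nx Mx exb] : xb \in M / M^`(1) by rewrite defA cycle_id.
  exists x => //; rewrite -quotientSK // quotient_cycle // defA exb //.
(* If r = p, then [M / L] is a p-group generated by one element modulo its Frattini subgroup, hence
   cyclic, and the derived subgroup lies in [L]. *)
have ner : r != p.
  apply: contraTneq ltL => erp; rewrite {}erp {r r_pr} in rq abq.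
  have pq : p.-group (M / L).
    rewrite /pgroup card_quotient // -(Lagrange_index sDM sLD) pnatM.
    by rewrite -!card_quotient //; apply/andP.
  suff cycq : cyclic (M / L).
    apply/negP=> /proper_subn/negP[]; rewrite -quotient_sub1 //.
    rewrite quotient_der // subG1; apply/eqP/derG1P; exact: cyclic_abelian.
  have /cyclicP : exists y, M / L = <[y]>.
    exists (coset L x); apply/esym.
    apply: (@Phi_nongen _ (M / L) [set coset L x]).
    apply/eqP; rewrite eqEsubset join_subG Phi_sub sub1set mem_quotient //=.
    apply: subset_trans (quotientS L defM) _; rewrite quotientMl //.
    rewrite quotient_cycle ?(subsetP nLM) // quotient_der // mul_subG //.
      by apply: subset_trans (der1_Phi pq) (joing_subl _ _).
    by rewrite cycle_subG mem_gen // inE set11 orbT.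
  by [].
have r'A : r^'.-group (M / M^`(1)) by rewrite (pi_pgroup pA) // !inE eq_sym.
have chX (X : {group gT}) : L \subset X -> X \subset M^`(1)%G -> M \subset 'N(X) ->
    X :=: L \/ X :=: M^`(1)%G.
  move=> sLX sXD nXM; have [-> | neX] := eqVneq (X : {set gT}) M^`(1); [by right | left].
  by apply: mx => //; apply/andP; rewrite properEneq neX.
have [R [B [sBM rR ntR chR oDL]]] := chief_supplement r_pr nsDM nsLM ltL chX abq r'A.
have le : #|M^`(1) / L| <= #|N|.
  by rewrite oDL; apply: (Phi_chief_module_le solM minN abN cMN r_pr sBM rR ntR chR).
apply: (@coverable_leq _ _ #|M^`(1) / L|.+1); first by rewrite ltnS.
apply: (@coverable_quotient _ M L) => //.
have hallD : r.-Hall(M / L) (M^`(1) / L).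
  rewrite /pHall quotientS //= rq -card_quotient ?quotient_norms //.
  by rewrite (card_isog (third_isog sLD nsLM nsDM)).
have nsDq : M^`(1) / L <| M / L by apply: quotient_normal.
have /splitsP[T /complP[tiT defT]] := SchurZassenhaus_split (pHall_Hall hallD) nsDq.
have abD := abelem_abelian abq.
have sTq : T \subset M / L by rewrite -defT mulG_subr.
apply: (@coverable_minnormal _ (M / L)%G T (M^`(1) / L)%G) => //=.
- by rewrite -[RHS]defT; apply: normC; apply: subset_trans sTq nDq.
- by rewrite setIC.
- by rewrite -quotient_der.
apply/negP=> cMD.
have cT : T \subset 'C(M^`(1) / L) := subset_trans sTq cMD.
have abT : abelian T.
  have : abelian ((M / L) / (M^`(1) / L)).
    by rewrite quotient_der // der_abelian.
  rewrite -defT quotientMidl.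
  by apply: contraLR => nab; rewrite -(isog_abelian (quotient_isog (subset_trans sTq nDq) tiT)).
have : abelian (M / L) by rewrite -defT abelianM abD abT.
move/derG1P; rewrite -quotient_der // => /eqP; rewrite -subG1 quotient_sub1 //.
by rewrite (negPf (proper_subn ltL)).
Qed.

Lemma p_group_der1_quotient (gT : finGroupType) (G K : {group gT}) :
  K <| G -> p_group (G / G^`(1)) -> p_group ((G / K) / (G / K)^`(1)).
Proof.
move=> nsKG /p_groupP[p _ pG]; apply: (@pgroup_p _ p).
have nKG := normal_norm nsKG.
apply: pnat_dvd pG; rewrite !card_quotient ?gFnorm //= -quotient_der // index_quotient //.
by apply: subset_trans (subsetIl _ _) nKG.
Qed.

Lemma p_group_der1_isog (aT gT : finGroupType) (A : {group aT}) (G : {group gT}) :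
  A \isog G -> p_group (A / A^`(1)) -> p_group (G / G^`(1)).
Proof.
move=> iso; rewrite /p_group /pgroup !card_quotient ?gFnorm // -!divgS ?der_sub //.
by rewrite (card_isog iso) (card_isog (isog_der 1 iso)).
Qed.

(** * Complements of a minimal normal subgroup *)

Section Complement.
Variable gT : finGroupType.
Implicit Types (G H M N T : {group gT}).

Lemma complement_isog G M N :
  G \subset 'N(N) -> M * N = G -> M :&: N = 1 -> M \isog G / N.
Proof.
move=> nNG defG tiMN; have sMG : M \subset G by rewrite -defG mulG_subl.
rewrite -defG quotientMidr; apply: quotient_isog; first exact: subset_trans nNG.
by rewrite setIC.
Qed.

Lemma complement_p_group G M N :
    N <| G -> M * N = G -> M :&: N = 1 -> p_group (G / G^`(1)) ->
  p_group (M / M^`(1)).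
Proof.
move=> nsNG defG tiMN pG.
have iso := complement_isog (normal_norm nsNG) defG tiMN.
have iso' : (G / N)%G \isog M by rewrite isog_sym.
exact: p_group_der1_isog iso' (p_group_der1_quotient nsNG pG).
Qed.

Lemma coverable_noncentral G M N :
    solvable G -> p_group (G / G^`(1)) -> minnormal N G -> abelian N ->
    M * N = G -> M :&: N = 1 -> ~~ (G \subset 'C(N)) ->
  coverable G #|N|.+1.
Proof.
move=> solG pG minN abN defG tiMN ncG.
have [/andP[ntN nNG] min] := mingroupP minN.
have sMG : M \subset G by rewrite -defG mulG_subl.
have sNG : N \subset G by rewrite -defG mulG_subr.
have nsNG : N <| G by apply/andP.
have nNM := subset_trans sMG nNG.
have solM := solvableS sMG solG.
have [sM'C | nsM'C] := boolP (M^`(1) \subset 'C(N)).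
  have nCG : G \subset 'N('C_G(N)) by rewrite normsI ?normG ?norms_cent.
  have sG'C : G^`(1) \subset 'C_G(N).
    apply: der1_min => //; apply: (@abelianS _ _ (M / 'C_G(N))).
      have sNC : N \subset 'C_G(N) by rewrite subsetI sNG.
      apply: subset_trans (quotientS _ (_ : G \subset M * 'C_G(N))) _.
        by rewrite -{1}defG mulgS.
      by rewrite quotientMidr.
    apply: sub_der1_abelian; rewrite subsetI sM'C andbT.
    exact: subset_trans (der_sub 1 M) sMG.
  apply: (coverable_minnormal minN abN defG tiMN _ ncG).
  by apply: subset_trans sG'C (subsetIr _ _).
(* It suffices to cover [M], hence its quotient by ['C_M(N)]; modulo this subgroup [N] keeps its
   order and becomes a faithful irreducible module. *)
apply: (coverable_complement nNG defG tiMN).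
pose K := 'C_M(N)%G.
have nsKM : K <| M by rewrite /normal subsetIl normsI ?normG ?norms_cent.
have [sKM nKM] := andP nsKM.
have nKN : N \subset 'N(K) by apply: cents_norm; rewrite centsC subsetIr.
have TI : K :&: N = 1 by apply/trivgP; rewrite -tiMN setSI.
have oN : #|N / K| = #|N| by rewrite -(card_isog (quotient_isog nKN TI)).
apply: (coverable_quotient nsKM); rewrite -oN.
apply: (@coverable_irreducible _ (M / K)%G (N / K)%G) => /=.
- exact: quotient_sol.
- apply/mingroupP; split=> [|X /andP[ntX nXM] sXN].
    by rewrite trivg_card1 oN -trivg_card1 ntN quotient_norms.
  have qX := quo_preI sXN; rewrite -[LHS]qX; apply: (congr1 (fun A : {set gT} => A / K)).
  apply: (min (N :&: coset K @*^-1 X)%G); last exact: subsetIl.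
  apply/andP; split.
    by apply: contra ntX => /eqP /= e; rewrite -qX e quotient1.
  rewrite -{1}defG mul_subG //.
    by apply: normsI => //; apply: norm_cosetpre.
  by apply: sub_abelian_norm => //; apply: subsetIl.
- exact: quotient_abelian.
- apply/trivgP/subsetP=> xb /setIP[/morphimP[x nKx Mx exb] /centP cxb].
  rewrite exb inE; apply/eqP/coset_id; rewrite inE Mx; apply/centP=> w Nw.
  have nKw := subsetP nKN w Nw; apply/commgP.
  rewrite -in_set1 -[[set 1]]TI inE; apply/andP; split.
    apply: coset_idr; first by rewrite groupR.
    rewrite morphR //= -exb; apply/eqP/commgP/cxb; exact: mem_quotient.
  by rewrite commgEr groupM // memJ_norm ?groupV // (subsetP nNM).
- apply: p_group_der1_quotient => //.
  exact: complement_p_group nsNG defG tiMN pG.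
apply: contra nsM'C => abMK.
by apply: subset_trans (der1_min nKM abMK) (subsetIr _ _).
Qed.


(** A maximal subgroup of the abelianization, which is nontrivial by solvability, is pulled back. *)
Lemma prime_index_exists M : solvable M -> M :!=: 1 -> p_group (M / M^`(1)) ->
  exists p, prime p /\ exists2 M0 : {group gT}, M0 <| M & #|M : M0| = p.
Proof.
move=> solM ntM /p_groupP[p p_pr pA]; exists p; split=> //.
have nsM' : M^`(1) <| M := der_normal 1 M.
have ntA : 1%G \proper (M / M^`(1))%G.
  rewrite proper1G -subG1 quotient_sub1 ?gFnorm //.
  exact: proper_subn (sol_der1_proper solM (subxx M) ntM).
have [e | [A0 maxA _]] := maximal_exists (proper_sub ntA).
  by case/negP: (proper_subn ntA); rewrite /= -e.
have sA0 := normal_sub (p_maximal_normal pA maxA).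
have sM0 : coset M^`(1) @*^-1 A0 \subset M by rewrite sub_cosetpre_quo.
exists (coset M^`(1) @*^-1 A0)%G.
  by apply: sub_der1_normal; rewrite ?sub_cosetpre.
rewrite -(p_maximal_index pA maxA) -[in RHS](cosetpreK A0) index_quotient_eq ?gFnorm //.
by apply: subset_trans (subsetIr _ _) _; apply: sub_cosetpre.
Qed.

Lemma prime_index_der1 (p : nat) G M :
  p.-group (G / G^`(1)) -> M <| G -> prime #|G : M| -> #|G : M| = p.
Proof.
move=> pA nsMG pr; have sG'M : G^`(1) \subset M.
  apply: der1_min; first exact: normal_norm.
  by apply/cyclic_abelian/prime_cyclic; rewrite card_quotient ?normal_norm.
have : p.-nat #|G : M|.
  apply: pnat_dvd pA; rewrite card_quotient ?gFnorm //; exact: indexgS.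
by rewrite pnatE // inE => /eqP.
Qed.

End Complement.

(** * Lower bounds and the induction *)

Section Lower.
Variable gT : finGroupType.
Implicit Types (G H M N T : {group gT}) (F : {set {group gT}}).

Lemma primary_covering_quotient G N F :
    N <| G -> is_primary_covering G F -> {in F, forall H, ~~ (G \subset N * H)} ->
  is_primary_covering (G / N)%G [set (H / N)%G | H in F].
Proof.
move=> nsNG /is_primary_coveringP[prF covF] nF; have [sNG nNG] := andP nsNG.
apply/is_primary_coveringP; split=> [_ /imsetP[H FH ->] | xb Gx px].
  have sHG := proper_sub (prF H FH).
  rewrite properE quotientS //=; apply: contra (nF H FH).
  by rewrite quotientSK.
have [p p_pr pxb] := p_groupP px.
have /morphimP[x nNx Gx' exb] := Gx.
(* [x] need not be primary, but its p-part is, and has the same image because [xb] is a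
   p-element. *)
have [H FH Hx] : exists2 H, H \in F & x.`_p \in gval H.
  apply: covF; first exact: groupX.
  exact: (@pgroup_p _ p) (p_elt_constt p x).
exists (H / N)%G; first exact: imset_f.
rewrite -(constt_p_elt pxb) exb -morph_constt //.
exact: mem_quotient.
Qed.

Lemma primary_covering_subgroup G T F :
    T \subset G -> is_primary_covering G F -> {in F, forall H, ~~ (T \subset gval H)} ->
  is_primary_covering T [set (T :&: H)%G | H in F].
Proof.
move=> sTG /is_primary_coveringP[prF covF] nF.
apply/is_primary_coveringP; split=> [_ /imsetP[H FH ->] | x Tx px].
  by rewrite properE subsetIl /= subsetI subxx /= nF.
have [H FH Hx] := covF x (subsetP sTG x Tx) px.
exists (T :&: H)%G; first exact: imset_f.
by rewrite inE Tx.
Qed.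

(** [H :&: N] is normalized by [H] and by the abelian [N], hence by [G]; it is not [N], as [H] is
    proper. *)
Lemma minnormal_complement G N H :
    minnormal N G -> abelian N -> H \proper G -> H * N = G -> H :&: N = 1.
Proof.
move=> minN abN prH defG; have [/andP[ntN nNG] min] := mingroupP minN.
have sHG := proper_sub prH.
apply/eqP; apply: contraT => ntI.
have eI : H :&: N = N.
  apply: (min (H :&: N)%G); rewrite ?subsetIr // ntI /=.
  rewrite -defG mul_subG //.
    by rewrite normsI ?normG // (subset_trans sHG).
  by apply: sub_abelian_norm; rewrite ?subsetIr.
case/negP: (proper_subn prH); rewrite -defG mulGSid //.
by rewrite -eI subsetIl.
Qed.

(** [H] also supplements [N], so it is a complement and has the order of [T]. *)
Lemma complement_maximal G N T H :
    minnormal N G -> abelian N -> T * N = G -> T :&: N = 1 -> H \proper G ->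
  T \subset H -> T = H.
Proof.
move=> minN abN defG tiTN prH sTH; apply: val_inj; apply/eqP => /=.
have [/andP[ntN nNG] _] := mingroupP minN.
have sNG : N \subset G by rewrite -defG mulG_subr.
have defG' : H * N = G.
  by apply/eqP; rewrite eqEsubset mul_subG ?(proper_sub prH) //= -{1}defG mulSg.
have tiHN := minnormal_complement minN abN prH defG'.
rewrite eqEcard sTH /= -(leq_pmul2r (cardG_gt0 N)).
by rewrite -!TI_cardMg // defG defG'.
Qed.

(** The [#|N|] conjugates of [M] under [N] are distinct complements, and none of them contains a
    nontrivial element of [N], which is primary. *)
Lemma noncentral_lower_bound G M N F :
    minnormal N G -> is_abelem N -> M * N = G -> M :&: N = 1 -> ~~ (G \subset 'C(N)) ->
    is_primary_covering G F ->
    (forall T, T * N = G -> T :&: N = 1 -> T \in F) ->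
  #|N| < #|F|.
Proof.
move=> minN /is_abelemP[s s_pr abN] defG tiMN ncG /is_primary_coveringP[prF covF] cF.
have cNN := abelem_abelian abN.
have [/andP[ntN nNG] min] := mingroupP minN.
have sNG : N \subset G by rewrite -defG mulG_subr.
have sMG : M \subset G by rewrite -defG mulG_subl.
have c1 : 'C_N(G) = 1.
  apply/eqP; apply: contraR ncG => nt.
  have <- : 'C_N(G) = N; last by rewrite centsC subsetIr.
  apply: (min 'C_N(G)%G); rewrite ?subsetIl // nt normsI //=.
  by rewrite norms_cent ?normG.
(* [[~ x, m]] lies in [M] and in [N], so [x] centralizes [M] and then [G]. *)
have nM1 x : x \in N -> x \in 'N(M) -> x = 1.
  move=> Nx nMx; apply/set1P; rewrite -[[set 1]]c1 inE Nx -defG centM inE.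
  rewrite (subsetP cNN x Nx) andbT.
  apply/centP=> m Mm; apply/commgP; rewrite -in_set1 -[[set 1]]tiMN inE.
  apply/andP; split; first by rewrite commgEr groupM // memJ_norm ?groupV.
  by rewrite commgEl groupM ?groupV // memJ_norm // (subsetP (subset_trans sMG nNG)).
pose X := [set (M :^ x)%G | x in N].
have oX : #|X| = #|N|.
  rewrite card_in_imset // => x y Nx Ny /(congr1 (@gval _)) /= e.
  apply/eqP; rewrite eq_mulgV1; apply/eqP; apply: nM1; first by rewrite groupM ?groupV.
  by rewrite inE conjsgM e conjsgK.
have tiX x : x \in N -> (M :^ x) :&: N = 1.
  by move=> Nx; rewrite -[X in _ :&: X](conjGid Nx) -conjIg tiMN conjs1g.
have sXF : X \subset F.
  apply/subsetP=> _ /imsetP[x Nx ->]; apply: cF => /=; last exact: tiX.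
  by rewrite -[X in _ * X](conjGid Nx) -conjsMg defG conjGid // (subsetP sNG).
have [n Nn ntn] := trivgPn _ ntN.
have [|H FH Hn] := covF n (subsetP sNG n Nn).
  by apply: (@pgroup_p _ s); apply: mem_p_elt (abelem_pgroup abN) Nn.
rewrite -oX proper_card // properE sXF; apply/subsetPn; exists H => //.
apply: contra ntn => /imsetP[x Nx eH].
by rewrite -in_set1 -[[set 1]](tiX x Nx) inE Nn andbT -[M :^ x]/(gval (M :^ x)%G) -eH.
Qed.

(** For [M0] of index p in [M], take the p + 1 subgroups of index p above [M0]. All except
    [M0 <*> N] are complements of [N], hence members of [F], and a member of [F] containing [N]
    makes up for the exception. *)
Lemma central_coverable G M N F :
    solvable G -> p_group (G / G^`(1)) -> minnormal N G -> is_abelem N ->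
    M * N = G -> M :&: N = 1 -> G \subset 'C(N) ->
    is_primary_covering G F ->
    (forall T, T * N = G -> T :&: N = 1 -> T \in F) ->
  coverable G #|F|.
Proof.
move=> solG pG minN /is_abelemP[s s_pr abN] defG tiMN cGN /is_primary_coveringP[prF covF] cF.
have cNN := abelem_abelian abN.
have [/andP[ntN nNG] min] := mingroupP minN.
have sNG : N \subset G by rewrite -defG mulG_subr.
have sMG : M \subset G by rewrite -defG mulG_subl.
have nsNG : N <| G by apply/andP.
have [n Nn ntn] := trivgPn _ ntN.
have eN : <[n]> = N.
  apply: (min <[n]>%G); last by rewrite cycle_subG.
  rewrite cycle_eq1 ntn; apply: cents_norm; apply: subset_trans cGN (centS _).
  by rewrite cycle_subG.
have oN : #|N| = s by rewrite -eN -orderE (abelem_order_p abN).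
have [H FH Hn] : exists2 H, H \in F & n \in gval H.
  apply: covF; first exact: (subsetP sNG).
  by apply: (@pgroup_p _ s); apply: mem_p_elt (abelem_pgroup abN) Nn.
have sNH : N \subset H by rewrite -eN cycle_subG.
have ntM : M :!=: 1.
  apply: contraTneq (prF H FH) => M1; rewrite properE negb_and negbK.
  by rewrite -defG M1 mul1g sNH orbT.
have pM := complement_p_group nsNG defG tiMN pG.
have [q [q_pr [M0 nsM0 iM0]]] := prime_index_exists (solvableS sMG solG) ntM pM.
have [sM0M nM0M] := andP nsM0.
have cMN : N \subset 'C(M) by rewrite centsC (subset_trans sMG).
have nsMG : M <| G by rewrite /normal sMG -defG mul_subG ?normG // cents_norm.
have oG : #|G| = (#|M| * s)%N by rewrite -defG TI_cardMg // oN.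
have iM : #|G : M| = s by rewrite -divgS // oG mulKn.
have cM0N : N \subset 'C(M0) := subset_trans cMN (centS sM0M).
have tiM0 : M0 :&: N = 1 by apply/trivgP; rewrite -tiMN setSI.
pose M1 := (M0 <*> N)%G.
have eM1 : M1 = M0 * N :> {set gT} by rewrite /= norm_joinEr // cents_norm.
have sM1G : M1 \subset G by rewrite join_subG sNG (subset_trans sM0M).
have nsM1 : M1 <| G.
  rewrite /normal sM1G -defG mul_subG //.
    by rewrite normsY // (subset_trans sMG).
  by apply: subset_trans (joing_subr M0 N) (normG _).
have iM1 : #|G : M1| = q.
  apply/eqP; rewrite -(eqn_pmul2l (cardG_gt0 M1)) Lagrange // eM1 TI_cardMg //.
  by rewrite oG oN -(Lagrange sM0M) iM0 mulnAC.
have [p p_pr pA] := p_groupP pG.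
(* [s] and [q] are the indices of the normal subgroups [M] and [M1], so both are the prime of
   [G / G^(1)]. *)
have esp : s = p by rewrite -iM; apply: prime_index_der1 pA nsMG _; rewrite iM.
have eqp : q = p by rewrite -iM1; apply: prime_index_der1 pA nsM1 _; rewrite iM1.
rewrite {}esp in s_pr abN oN oG iM *; rewrite {}eqp in q_pr iM0 iM1 *.
have nNM : ~~ (N \subset M).
  by apply: contra ntN => sNM; rewrite -subG1 -tiMN subsetI sNM subxx.
have neM : M1 :!=: M.
  by apply: contraNneq nNM => <-; apply: joing_subr.
have [X [covX oX hX]] := prime_index_family p_pr nsM1 nsMG iM1 iM neM.
exists X => //; rewrite oX.
pose X' := [set T in X | ~~ (N \subset gval T)].
have sX'F : X' \subset F.
  apply/subsetP=> T; rewrite inE => /andP[XT nNT]; have [_ iT] := hX T XT.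
  have /is_coveringP[prX _] := covX; have sTG := proper_sub (prX T XT).
  have ti : T :&: N = 1 by rewrite setIC; apply: prime_TIg; rewrite ?oN.
  apply: cF => //; apply/eqP; rewrite eqEcard mul_subG //= TI_cardMg // oN.
  by rewrite -(Lagrange sTG) iT.
have leX : p.+1 <= #|X'|.+1.
  rewrite -oX; apply: leq_trans (_ : #|M1 |: X'| <= _); last first.
    by rewrite cardsU1 addnC -addn1 leq_add2l leq_b1.
  apply: subset_leq_card; apply/subsetP=> T XT; rewrite !inE XT /=.
  have [sNT | ] := boolP (N \subset T); last by rewrite orbT.
  rewrite orbF; have [sIT iT] := hX T XT.
  have sTG : T \subset G by have /is_coveringP[prX _] := covX; exact: proper_sub (prX T XT).
  rewrite eq_sym; apply/eqP/val_inj/eqP; rewrite eqEcard /= join_subG sNT andbT.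
  apply/andP; split; first by apply: subset_trans sIT; rewrite subsetI sM0M joing_subl.
  by rewrite -(leq_pmul2r (prime_gt0 p_pr)) -{1}iT -iM1 !Lagrange.
apply: leq_trans leX _; apply: proper_card; rewrite properE sX'F.
by apply/subsetPn; exists H => //; rewrite inE sNH andbF.
Qed.

End Lower.

Lemma coverable_primary (gT : finGroupType) (G : {group gT}) (F : {set {group gT}}) :
    solvable G -> p_group (G / G^`(1)) -> is_primary_covering G F ->
  coverable G #|F|.
Proof.
(* The induction also varies [gT], since it passes to [G / N]. *)
have [n] := ubnP #|G|; elim: n => // n IHn in gT G F *; rewrite ltnS => leGn solG pG covF.
have [prF covF'] := is_primary_coveringP covF.
have ntG : G :!=: 1.
  apply: contraT => /negPn/eqP G1; have [|H FH _] := covF' 1 (group1 G).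
    by rewrite cycle1 p_group1.
  by have := prF H FH; rewrite G1 properE sub1G andbF.
have [N minN sNG] := minnormal_exists ntG (normG G).
have [nNG ntN abN] := minnormal_solvable minN sNG solG.
have nsNG : N <| G by apply/andP.
have [s s_pr abN'] := is_abelemP abN; have cNN := abelem_abelian abN'.
have [/forall_inP noM | ] := boolP [forall H in F, ~~ (G \subset N * H)].
  have covq := primary_covering_quotient nsNG covF noM.
  apply: (coverable_quotient nsNG).
  apply: coverable_leq (leq_imset_card _ _) (IHn _ _ _ _ _ _ covq).
  - exact: leq_trans (ltn_quotient ntN sNG) leGn.
  - exact: quotient_sol.
  exact: p_group_der1_quotient.
case/forall_inPn=> M FM /negPn sGM.
have prM := prF M FM; have sMG := proper_sub prM.
have defG : M * N = G.
  apply/eqP; rewrite eqEsubset mul_subG //=.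
  by rewrite -(normC (subset_trans sMG nNG)) in sGM *.
have tiMN := minnormal_complement minN cNN prM defG.
have [/forallP allF | ] := boolP [forall T : {group gT},
    (T * N == G :> {set gT}) ==> (T :&: N == 1 :> {set gT}) ==> (T \in F)].
  have cF (T : {group gT}) : T * N = G -> T :&: N = 1 -> T \in F.
    by move=> /eqP e /eqP ti; have := allF T; rewrite e ti.
  have [cGN | ncGN] := boolP (G \subset 'C(N)).
    exact: central_coverable solG pG minN abN defG tiMN cGN covF cF.
  apply: coverable_leq (noncentral_lower_bound minN abN defG tiMN ncGN covF cF) _.
  exact: coverable_noncentral solG pG minN cNN defG tiMN ncGN.
case/forallPn=> T; rewrite !negb_imply => /and3P[/eqP defG' /eqP tiTN nFT].
have sTG : T \subset G by rewrite -defG' mulG_subl.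
have covT := primary_covering_subgroup sTG covF _.
apply: (coverable_complement nNG defG' tiTN).
apply: coverable_leq (leq_imset_card _ _) (IHn _ _ _ _ _ _ (covT _)).
- apply: leq_trans leGn; rewrite -defG' TI_cardMg //.
  by rewrite ltn_Pmulr // cardG_gt1.
- exact: solvableS solG.
- exact: complement_p_group nsNG defG' tiTN pG.
(* A member of [F] containing [T] would equal [T], which is not in [F]. *)
move=> H FH; apply: contra nFT => sTH.
by rewrite (complement_maximal minN cNN defG' tiTN (prF H FH) sTH).
Qed.

(** The Sylow subgroups consist of primary elements and generate [G], so no single proper subgroup
    contains them all. *)
Lemma primary_covering_gt1 (gT : finGroupType) (G : {group gT}) F :
  is_primary_covering G F -> 1 < #|F|.
Proof.
case/is_primary_coveringP=> prF covF; rewrite ltnNge; apply/negP=> le1.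
have [H0 FH0 _] : exists2 H, H \in F & 1 \in gval H.
  by apply: covF => //; rewrite cycle1 p_group1.
case/negP: (proper_subn (prF H0 FH0)).
rewrite -{1}(Sylow_gen G) gen_subG; apply/bigcupsP=> P /SylowP[p p_pr sylP].
apply/subsetP=> x Px; have [sPG pP _] := and3P sylP.
have [|H FH Hx] := covF x (subsetP sPG x Px).
  by apply: (@pgroup_p _ p); apply: mem_p_elt pP Px.
by rewrite -(card_le1_eqP le1 H0 H FH0 FH).
Qed.

Lemma primary_covering2 (gT : finGroupType) (G : {group gT}) :
  ~~ p_group (G / G^`(1)) -> exists2 F, is_primary_covering G F & #|F| <= 2.
Proof.
move=> npA; set A := (G / G^`(1))%G.
have nilA : nilpotent A by apply/abelian_nil/der_abelian.
have nG : G \subset 'N(G^`(1)) := gFnorm _ _.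
(* As p divides [#|A|] and [A] is not a p-group, [A] is not a p'-group either, so both preimages are
   proper. *)
pose p := pdiv #|A|; pose f (pi : nat_pred) := (coset G^`(1) @*^-1 'O_pi(A))%G.
have prf pi : ~~ pi.-group A -> f pi \proper G.
  move=> npi; rewrite -{1}(quotientGK (der_normal 1 G)) cosetpre_proper.
  rewrite properEneq pcore_sub andbT; apply: contra npi => /eqP e.
  by rewrite -[A : {set _}]e pcore_pgroup.
have inf pi x : x \in G -> pi.-elt x -> x \in f pi.
  move=> Gx pix; have nx := subsetP nG x Gx.
  rewrite mem_morphpre // (mem_Hall_pcore (nilpotent_pcore_Hall pi nilA)).
    exact: morph_p_elt.
  exact: mem_quotient.
have ntA : 1 < #|A|.
  by rewrite cardG_gt1; apply: contra npA => /eqP ->; apply: p_group1.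
have p_pr : prime p by apply: pdiv_prime.
exists [set f p; f p^']; last by rewrite cards2; case: (_ == _).
apply/is_primary_coveringP; split=> [H /set2P[] -> | x Gx /p_groupP[q q_pr qx]].
- by apply: prf; apply: contra npA; apply: pgroup_p.
- apply: prf; apply/negP=> p'A; have := pdiv_dvd #|A|; rewrite -/p => pdA.
  have := pnat_dvd pdA p'A; rewrite pnatE // !inE eqxx //.
have [eqp | neq] := eqVneq q p.
  by exists (f p); [rewrite !inE eqxx | apply: inf => //; rewrite -eqp].
exists (f p^'); first by rewrite !inE eqxx orbT.
by apply: inf => //; apply: (pi_pnat qx); rewrite !inE.
Qed.

Theorem theorem1 (gT : finGroupType) (G : {group gT})
    (solG : solvable G) (ncpG : ~~ (cyclic G && p_group G)) :
  (~~ p_group (G / G^`(1)) -> sigma0 G = Some 2) /\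
  (p_group (G / G^`(1)) -> sigma0 G = sigma G).
Proof.
split=> [npA | pA].
  apply/min_sizeP; split; last by move=> F /primary_covering_gt1.
  have [F covF leF] := primary_covering2 npA.
  exists F => //; apply/eqP; rewrite eqn_leq leF.
  exact: primary_covering_gt1 covF.
have subcov F : is_covering G F -> is_primary_covering G F.
  case/is_coveringP=> prF covF; apply/is_primary_coveringP; split=> // x Gx _.
  exact: covF.
case e: (sigma0 G) => [n|]; apply/esym.
  have /min_sizeP[[F covF oF] minF] := e.
  have [F' covF' leF'] := coverable_primary solG pA covF.
  apply/min_sizeP; split; last by move=> F1 /subcov/minF.
  by exists F' => //; apply/eqP; rewrite eqn_leq -{1}oF leF' minF ?subcov.
(* Without a primary covering there is no covering either, so both values are infinite. *)
have /min_sizeN nF := e.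
by apply/min_sizeN=> F; apply: contra (nF F); apply: subcov.
Qed.
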